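(* Let $d\ge 1$ and let $\omega_1,\ldots,\omega_d$ be positive real numbers such that $1,\omega_1,\ldots,\omega_d$ form a $\mathbb{Q}$-basis for an algebraic number field $\Phi\subset\mathbb{R}$. For $\mathcal{E}>1$ let $\varepsilon_1(\mathcal{E})<\cdots<\varepsilon_{\ell(\mathcal{E})}(\mathcal{E})$ be the energy levels in the window $[\mathcal{E},\mathcal{E}+1)$ (see context). Then there exist a finite set $\mathcal{S}=\{s_1,\ldots,s_J\}\subset\Phi$ (with $s_1,\ldots,s_J$ distinct) and a rescaling factor $u(\mathcal{E})>1$, defined for each $\mathcal{E}>1$, such that the following hold. (1) (Uniform labeling) For every $\mathcal{E}>1$ the rescaled spacings satisfy $$\overline{\delta_i}(\mathcal{E}) := u(\mathcal{E})\bigl(\varepsilon_{i+1}(\mathcal{E})-\varepsilon_i(\mathcal{E})\bigr)\in\mathcal{S}\qquad\text{for } 1\le i\le \ell(\mathcal{E})-1.$$ (2) (Quasiperiodicity) For $1\le j\le J$ let $p_j(\mathcal{E})$ denote the proportion of the rescaled spacings $\overline{\delta_i}(\mathcal{E})$, $1\le i\le\ell(\mathcal{E})-1$, such that $\overline{\delta_i}(\mathcal{E})=s_j$. Then there are integers $0\le k,r\le d+1$, a Lipschitz continuous function $$g:\mathbb{T}^k\times[0,1]^r\to P:=\Bigl\{(p_1,\ldots,p_J):\ \textstyle\sum_j p_j=1,\ p_j\ge 0\Bigr\},$$ angles $\boldsymbol{\theta}=(\theta_1,\ldots,\theta_k)\in\mathbb{R}^k$, rates $\boldsymbol{\beta}=(\beta_1,\ldots,\beta_r)\in\mathbb{R}^r$,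 and $0<\alpha<1$ such that, as $\mathcal{E}\to\infty$, $$(p_1(\mathcal{E}),\ldots,p_J(\mathcal{E})) = g\bigl(\boldsymbol{\theta}\log\mathcal{E},\ \{\boldsymbol{\beta}\log\mathcal{E}\}\bigr)+\mathcal{O}(\alpha^{\log\mathcal{E}}).$$
   Context: The energy levels (of the $(d+1)$-dimensional quantum harmonic oscillator with ratios of frequencies $\omega_1,\ldots,\omega_d>0$, in normalized energy units) are the real numbers of the form $\varepsilon=m_0+m_1\omega_1+\cdots+m_d\omega_d$ with $m_0,\ldots,m_d$ non-negative integers. For $\mathcal{E}>1$, $\ell(\mathcal{E})$ is the number of energy levels in $[\mathcal{E},\mathcal{E}+1)$ and $\varepsilon_1(\mathcal{E})<\cdots<\varepsilon_{\ell(\mathcal{E})}(\mathcal{E})$ lists them in increasing order. $\mathbb{T}=\mathbb{R}/\mathbb{Z}$; the vector $\boldsymbol{\theta}\log\mathcal{E}\in\mathbb{R}^k$ is reduced modulo $\mathbb{Z}^k$ to give a point of $\mathbb{T}^k$. $\{x\}$ denotes the fractional part of a real number $x$, and $\{\boldsymbol{\beta}\log\mathcal{E}\}:=(\{\beta_1\log\mathcal{E}\},\ldots,\{\beta_r\log\mathcal{E}\})\in[0,1]^r$. The error term $\mathcal{O}(\cdot)$ for vectors is understood componentwise. *)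

(* Defs.v *)
From HB Require Import structures.
From mathcomp Require Import all_boot all_order all_algebra all_field.
From mathcomp Require Import finmap generic_quotient ring_quotient.
From mathcomp Require Import all_classical all_reals all_analysis.

Set Implicit Arguments.
Unset Strict Implicit.
Unset Printing Implicit Defensive.

Import Order.TTheory GRing.Theory Num.Theory.
Import numFieldNormedType.Exports.

Local Open Scope classical_set_scope.
Local Open Scope ring_scope.
Local Open Scope quotient_scope.

(* Indices run from 0: the i-th frequency ratio, level, spacing below is the
   (i+1)-st one in one-based notation. *)

Definition energy_levels (R : realType) (d : nat) (omega : 'I_d -> R) : set R :=
  [set e | exists (m0 : nat) (m : 'I_d -> nat),
     e = m0%:R + \sum_(i < d) (m i)%:R * omega i].

(* [fset_set] is only meaningful on finite sets; see [window_levelsP]. *)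
Definition window_levels (R : realType) (d : nat) (omega : 'I_d -> R)
    (E : R) : seq R :=
  sort <=%R (fset_set (energy_levels omega `&` `[E, E + 1[)).

Definition spacings (R : realType) (d : nat) (omega : 'I_d -> R)
    (E : R) : seq R :=
  let eps := window_levels omega E in
  [seq eps`_i.+1 - eps`_i | i <- iota 0 (size eps).-1].

Definition rescaled_spacings (R : realType) (d : nat) (omega : 'I_d -> R)
    (u : R -> R) (E : R) : seq R :=
  [seq u E * delta | delta <- spacings omega E].

(* Equal to 0 when [xs] is empty. *)
Definition proportion (R : realType) (xs : seq R) (x : R) : R :=
  (count_mem x xs)%:R / (size xs)%:R.

Definition integers (R : realType) : {pred R} := fun x => x \is a Num.int.

Lemma integers_zmod_closed (R : realType) : zmod_closed (@integers R).
Proof. by split=> [|x y]; [exact: rpred0 | exact: rpredB]. Qed.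

HB.instance Definition _ (R : realType) :=
  GRing.isZmodClosed.Build R (@integers R) (integers_zmod_closed R).

Definition circle (R : realType) : Type := Quotient.quot (@integers R).

HB.instance Definition _ (R : realType) := GRing.Zmodule.on (circle R).
HB.instance Definition _ (R : realType) :=
  EqQuotient.copy (circle R) (Quotient.quot (@integers R)).

Lemma circle_eqP (R : realType) (x y : R) :
  reflect (\pi_(circle R) x = \pi_(circle R) y) (x - y \is a Num.int).
Proof.
by rewrite -[_ \is a Num.int]/(x - y \in @integers R) Quotient.idealrBE; exact: eqP.
Qed.

(* The quotient metric on R/Z. *)
Definition circle_dist (R : realType) (a b : circle R) : R :=
  inf [set `|x - y| | x in [set x : R | \pi_(circle R) x = a] &
                      y in [set y : R | \pi_(circle R) y = b]].

Definition torus_dist (R : realType) (k : nat) (a b : 'rV[circle R]_k) : R :=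
  \big[Num.max/0]_(i < k) circle_dist (a 0 i) (b 0 i).

Definition to_torus (R : realType) (k : nat) (x : 'rV[R]_k) : 'rV[circle R]_k :=
  map_mx (\pi_(circle R)) x.

Definition frac_part (R : realType) (x : R) : R := x - (Num.floor x)%:~R.

Definition unit_cube (R : realType) (r : nat) : set 'rV[R]_r :=
  [set b | forall i, 0 <= b 0 i <= 1].

Definition prob_simplex (R : realType) (J : nat) : set 'rV[R]_J :=
  [set p | \sum_(j < J) p 0 j = 1 /\ forall j, 0 <= p 0 j].

(* Lipschitz continuity on T^k x [0,1]^r for the product (maximum) metric; the
   values of [g] off [unit_cube R r] are irrelevant. *)
Definition torus_cube_lipschitz (R : realType) (k r J : nat)
    (g : 'rV[circle R]_k * 'rV[R]_r -> 'rV[R]_J) : Prop :=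
  exists L : R, forall (a a' : 'rV[circle R]_k) (b b' : 'rV[R]_r),
    unit_cube b -> unit_cube b' ->
    `|g (a, b) - g (a', b')| <= L * Num.max (torus_dist a a') `|b - b'|.

Lemma energy_window_finite (R : realType) (d : nat) (omega : 'I_d -> R) (E : R) :
  (forall i, 0 < omega i) -> finite_set (energy_levels omega `&` `[E, E + 1[).
Proof.
move=> omega0.
pose N0 := Num.truncn (E + 1).
pose N i := Num.truncn ((E + 1) / omega i).
pose K := (maxn N0 (\max_(i < d) N i)).+1.
pose F (p : 'I_K * {ffun 'I_d -> 'I_K}) : R :=
  (p.1 : nat)%:R + \sum_(i < d) (p.2 i : nat)%:R * omega i.
apply: (@sub_finite_set _ _ (F @` setT)); last first.
  exact/finite_image/finite_finset.
move=> e [[m0 [m ->]]] /=; rewrite in_itv/= => /andP[_ ltE].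
have sum0 : 0 <= \sum_(i < d) (m i)%:R * omega i.
  by apply: sumr_ge0 => i _; rewrite mulr_ge0// ltW.
have m0K : (m0 < K)%N.
  rewrite ltnS leq_max; apply/orP; left; rewrite truncn_ge_nat.
    by rewrite ltW// (le_lt_trans _ ltE)// lerDl.
  by rewrite ltW// (le_lt_trans _ ltE)// addr_ge0.
have mK i : (m i < K)%N.
  have lti : (m i)%:R * omega i < E + 1.
    apply: le_lt_trans ltE; rewrite (bigD1 i)//= addrCA lerDl addr_ge0//.
    by apply: sumr_ge0 => j _; rewrite mulr_ge0// ltW.
  rewrite ltnS leq_max; apply/orP; right.
  apply: leq_trans (leq_bigmax i); rewrite truncn_ge_nat.
    by rewrite ler_pdivlMr// ltW.
  by rewrite divr_ge0// ?(ltW (omega0 i))// ltW// (le_lt_trans _ lti)// mulr_ge0// ltW.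
exists (Ordinal m0K, [ffun i => Ordinal (mK i)]) => //.
by rewrite /F /=; congr (_ + _); apply: eq_bigr => i _; rewrite ffunE.
Qed.

Lemma window_levelsP (R : realType) (d : nat) (omega : 'I_d -> R) (E : R) :
  (forall i, 0 < omega i) ->
  sorted <%R (window_levels omega E) /\
  (forall e, e \in window_levels omega E <->
     energy_levels omega e /\ E <= e < E + 1).
Proof.
move=> omega0; have fin := energy_window_finite E omega0.
split=> [|e].
  by rewrite lt_sorted_uniq_le sort_uniq fset_uniq/= sort_sorted//; exact: le_total.
rewrite mem_sort in_fset_set// inE /= in_itv/=; by [].
Qed.

(* Main.v *)
Require Import Defs.
From HB Require Import structures.
From mathcomp Require Import all_boot all_order all_algebra all_field.
From mathcomp Require Import generic_quotient mxred complex ring lra zify.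
From mathcomp Require Import all_classical all_reals all_analysis.

Set Implicit Arguments.
Unset Strict Implicit.
Unset Printing Implicit Defensive.

Import Order.TTheory GRing.Theory Num.Theory.
Import numFieldNormedType.Exports.

Local Open Scope classical_set_scope.
Local Open Scope ring_scope.

(** Write [L] for the lattice of elements of [Phi] with integer coordinates on
    the basis [1 :: w].  The energy levels are the values under [iota] of the elements of [L] all of whose coordinates are nonnegative, so
    the gap above a level [iota x] is the least positive [iota y], [y] in [L],
    for which [x + y] still lies in the positive orthant.

    Labeling.  Elements of [Phi] are measured by all the embeddings of [Phi] in
    the complex numbers; coordinates are linear functions of these embeddings
    ([exists_embeddings]).  The pigeonhole argument behind the theorem of
    Dirichlet gives units [u] of the multiplier ring of [L] which are of size
    E^d at [iota] and of size 1/E at every other embedding ([unit_at_scale]).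
    In the window at [E] the gaps are of size at most a constant times E^-d
    ([next_level_close]) and the coordinates of the corresponding elements are
    O(E), so multiplication by such a unit brings all of them into one bounded
    part of [L], which is a finite set ([spacing_bounded]).

    Choice of the units.  The vectors of logarithms of absolute values of these
    units stay at bounded distance from the line directed by (d, -1, ..., -1),
    so this direction is a real combination, with coefficients [b i], of the
    logarithm vectors of finitely many units [eta i] ([scaling_units]).  Up to
    a constant factor the rescaling unit is the product of the
    [eta i ^ floor (b i * ln E)].  At an embedding other than [iota], the
    product of E^-1 with the inverse of this unit is therefore a fixed smooth
    function of the fractional parts of the [b i * ln E] and of one phase
    linear in [ln E] ([inv_scaling_unit_orbit]), while at [iota] it is O(1/E).

    Proportions.  Let [u] be the rescaling unit.  The levels of the window that
    remain levels after adding each of several shifts [iota (p / u)] come from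
    a translate of the positive orthant, because an intersection of translated
    orthants is one; their number is the number of lattice points of a simplex
    ([count_above], [size_simplex_points]).  Divided by E^d it is, up to
    O(1/E), a Lipschitz function of the coordinates of the [p / u] divided by
    [E].  Being followed by a given gap is a boolean combination of such
    conditions ([spacing_pattern]), so the proportion of each gap is, up to
    O(1/E), a Lipschitz function along the orbit of the phases and fractional
    parts ([proportion_lip]).  It extends to the whole product of the torus and
    the cube by the formula of McShane, followed by a Lipschitz retraction onto
    the simplex ([quasiperiodic_extension]).  Since 1/E is the power of exponent
    [ln E] of 1/e, one can take 1/e for [alpha]. *)

(** * Powers of positive parts *)

Section PowerBounds.
Context (R : realFieldType).
Implicit Types a b t M : R.

Lemma subrXX_le k a b : 0 <= b <= a ->
  a ^+ k.+1 - b ^+ k.+1 <= k.+1%:R * (a - b) * a ^+ k.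
Proof.
move=> /andP[b0 ab]; have a0 := le_trans b0 ab.
rewrite subrXX [k.+1%:R * _]mulrC -mulrA ler_wpM2l ?subr_ge0//.
have -> : k.+1%:R * a ^+ k = \sum_(i < k.+1) a ^+ k.
  by rewrite sumr_const card_ord mulr_natl.
apply: ler_sum => i _ /=.
have -> : a ^+ k = a ^+ (k - i) * a ^+ i by rewrite -exprD subnK// -ltnS.
by rewrite ler_wpM2l ?exprn_ge0// lerXn2r.
Qed.

Lemma subrXX_ge k a b : 0 <= b <= a ->
  k.+1%:R * (a - b) * b ^+ k <= a ^+ k.+1 - b ^+ k.+1.
Proof.
move=> /andP[b0 ab]; have a0 := le_trans b0 ab.
rewrite subrXX [k.+1%:R * _]mulrC -mulrA ler_wpM2l ?subr_ge0//.
have -> : k.+1%:R * b ^+ k = \sum_(i < k.+1) b ^+ k.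
  by rewrite sumr_const card_ord mulr_natl.
apply: ler_sum => i _ /=.
have -> : b ^+ k = b ^+ (k - i) * b ^+ i by rewrite -exprD subnK// -ltnS.
by rewrite ler_wpM2r ?exprn_ge0// lerXn2r.
Qed.

Definition pos t : R := Num.max t 0.

Lemma pos_ge0 t : 0 <= pos t. Proof. by rewrite le_max lexx orbT. Qed.

Lemma ger0_pos t : 0 <= t -> pos t = t. Proof. by move=> ?; rewrite /pos max_l. Qed.

Lemma ler0_pos t : t <= 0 -> pos t = 0. Proof. by move=> ?; rewrite /pos max_r. Qed.

Lemma le_pos : {homo pos : a b / a <= b}.
Proof. by move=> a b ab; rewrite /pos ge_max !le_max ab lexx orbT. Qed.

Lemma pos_lip a b : `|pos a - pos b| <= `|a - b|.
Proof.
wlog ab : a b / a <= b.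
  by move=> H; case/orP: (le_total a b) => /H//; rewrite distrC [leRHS]distrC.
rewrite distrC ger0_norm ?subr_ge0 ?le_pos// distrC ger0_norm ?subr_ge0//.
rewrite /pos; case: (leP b 0) => b0; case: (leP a 0) => a0; lra.
Qed.

Lemma pos_exp_lip k M a b : a <= M -> b <= M -> 0 <= M ->
  `|pos a ^+ k.+1 - pos b ^+ k.+1| <= k.+1%:R * M ^+ k * `|a - b|.
Proof.
wlog ab : a b / a <= b.
  move=> H aM bM M0; case/orP: (le_total a b) => /H; first exact.
  by rewrite distrC [`|a - b|]distrC; apply.
move=> aM bM M0; have pab := le_pos ab.
rewrite distrC ger0_norm; last by rewrite subr_ge0 lerXn2r ?nnegrE ?pos_ge0.
apply: le_trans (@subrXX_le k (pos b) (pos a) _) _; first by rewrite pos_ge0.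
rewrite -!mulrA ler_wpM2l// mulrC; apply: ler_pM.
- by rewrite exprn_ge0// pos_ge0.
- by rewrite subr_ge0.
- by rewrite lerXn2r ?nnegrE ?pos_ge0// -(ger0_pos M0) le_pos.
- by rewrite distrC; apply: le_trans (pos_lip b a); rewrite ler_norm.
Qed.

End PowerBounds.

(** * Lattice points in a simplex *)

Section SimplexCount.
Context (R : realType).
Implicit Types (ws : seq R) (X : R).

Fixpoint dot (t : seq nat) ws : R :=
  match t, ws with m :: t', w :: ws' => m%:R * w + dot t' ws' | _, _ => 0 end.

(** The points t of N^k with t . ws < X, listed by their first coordinate, which is at
    most X / w; the count can then be done by induction on the dimension. *)
Fixpoint simplex_points ws X : seq (seq nat) :=
  if ws is w :: ws' then
    [seq m :: t | m <- iota 0 (Num.truncn (X / w)).+1,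
                  t <- simplex_points ws' (X - m%:R * w)]
  else if 0 < X then [:: [::]] else [::].

Lemma simplex_points_cons w ws X : simplex_points (w :: ws) X =
  flatten [seq [seq m :: t | t <- simplex_points ws (X - m%:R * w)]
          | m <- iota 0 (Num.truncn (X / w)).+1].
Proof. by []. Qed.

(** The volume of the simplex { t >= 0, t . ws <= 1 }. *)
Definition simplex_cst ws : R := (\prod_(w <- ws) w)^-1 / (size ws)`!%:R.

Lemma dot_ge0 t ws : all (> 0) ws -> 0 <= dot t ws.
Proof.
elim: t ws => [|m t IHt] [|w ws]//= /andP[w0 /IHt t0].
by rewrite addr_ge0// mulr_ge0// ltW.
Qed.

Lemma mem_simplex_points ws X t : all (> 0) ws ->
  (t \in simplex_points ws X) = (size t == size ws) && (dot t ws < X).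
Proof.
elim: ws X t => [|w ws IHws] X t.
  by move=> _ /=; case: ltP => X0; case: t => [|? ?] //=; rewrite ?inE/= ltNge X0.
rewrite simplex_points_cons => /andP[w0 ws0]; apply/idP/idP.
  case/flatten_mapP=> m mX /mapP[t' t'X ->].
  by move: t'X; rewrite IHws//= eqSS ltrBrDl.
case: t => [//|m t] /andP[]; rewrite [size _]/= eqSS [dot _ _]/= => ts tX.
apply/flatten_mapP; exists m; last first.
  by apply: map_f; rewrite IHws// ts ltrBrDl.
rewrite mem_iota add0n ltnS /= truncn_ge_nat; last first.
  rewrite divr_ge0 ?(ltW w0)// ltW// (le_lt_trans _ tX)//.
  by rewrite addr_ge0 ?dot_ge0// mulr_ge0// ltW.
by rewrite ler_pdivlMr// ltW// (le_lt_trans _ tX)// lerDl dot_ge0.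
Qed.

Lemma simplex_points_uniq ws X : uniq (simplex_points ws X).
Proof.
elim: ws X => [|w ws IHws] X; first by rewrite /=; case: ifP.
rewrite simplex_points_cons; apply: allpairs_uniq_dep => [|m _|]; [exact: iota_uniq|exact: IHws|].
by move=> /= [m t] [m' t'] _ _ /= [-> ->].
Qed.

Lemma simplex_points0 ws X : all (> 0) ws -> X <= 0 -> simplex_points ws X = [::].
Proof.
move=> ws0 X0; case E : simplex_points => [//|t s].
have : t \in simplex_points ws X by rewrite E mem_head.
rewrite mem_simplex_points// => /andP[_ /lt_le_trans/(_ X0)].
by rewrite ltNge dot_ge0.
Qed.

Lemma simplex_cst_ge0 ws : all (> 0) ws -> 0 <= simplex_cst ws.
Proof.
move=> /allP ws0; rewrite divr_ge0// invr_ge0 big_seq prodr_ge0// => w /ws0 /ltW//.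
Qed.

(** The unit cubes with lower corner at the counted points cover the simplex of size X and
    are contained in the simplex enlarged by the sum of ws.  The proof by slices compares
    each slice with the increment of a power over a step w, and the increments telescope. *)
Lemma size_simplex_points ws X : all (> 0) ws ->
  (0 < X -> simplex_cst ws * X ^+ size ws <= (size (simplex_points ws X))%:R) /\
  (0 < X -> (size (simplex_points ws X))%:R
     <= simplex_cst ws * (X + \sum_(w <- ws) w) ^+ size ws).
Proof.
elim: ws X => [|w ws IHws] X.
  move=> _; rewrite /= /simplex_cst !big_nil ?invr1 ?mul1r ?addr0 ?expr0.
  by case: (ltP 0 X).
rewrite simplex_points_cons [size (_ :: _)]/= => /andP[w0 ws0]; set k := size ws; set c' := simplex_cst ws.
have c'0 : 0 <= c' := simplex_cst_ge0 ws0.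
set O' := \sum_(v <- ws) v.
have O'0 : 0 <= O' by rewrite /O' big_seq sumr_ge0// => v /(allP ws0)/ltW.
have cE : simplex_cst (w :: ws) = c' / (k.+1%:R * w).
  rewrite /c' /simplex_cst /= factS natrM big_cons !invfM -/k.
  by rewrite [k.+1%:R^-1 * _]mulrC !mulrA; ring.
set c := simplex_cst (w :: ws) in cE *.
have kw0 : 0 < k.+1%:R * w by rewrite mulr_gt0.
have c0 : 0 <= c by rewrite cE divr_ge0// ltW.
have c'E : c' = c * (k.+1%:R * w) by rewrite cE divfK// gt_eqF.
set T := Num.truncn (X / w).
have sizeE : (size [seq m :: t | m <- iota 0 T.+1,
    t <- simplex_points ws (X - m%:R * w)])%:R =
  \sum_(0 <= m < T.+1) (size (simplex_points ws (X - m%:R * w)))%:R :> R.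
  rewrite size_allpairs_dep sumnE big_map -/(index_iota 0 T.+1) natr_sum.
  by rewrite /index_iota subn0.
rewrite sizeE; split=> X0.
  (* The positive part makes the last, incomplete, increment correct. *)
  have low Y : 0 <= Y -> c * (Y ^+ k.+1 - pos (Y - w) ^+ k.+1) <=
      (size (simplex_points ws Y))%:R.
    rewrite le_eqVlt => /orP[/eqP <-|Y0].
      by rewrite ler0_pos ?sub0r ?oppr_le0 ?(ltW w0)// expr0n subrr mulr0.
    have [/(_ Y0) h _] := IHws Y ws0; apply: le_trans h; rewrite -/c' c'E.
    rewrite -mulrA ler_wpM2l//.
    have [Yw|Yw] := leP Y w.
      rewrite ler0_pos ?subr_le0// expr0n subr0 exprS ler_wpM2r ?exprn_ge0 ?(ltW Y0)//.
      by rewrite (le_trans Yw)// ler_peMl ?ler1n// ltW.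
    rewrite ger0_pos ?subr_ge0 ?(ltW Yw)//.
    apply: le_trans (@subrXX_le _ k Y (Y - w) _) _; last by rewrite opprB addrC subrK.
    by rewrite subr_ge0 ltW//= gerBl ltW.
  pose f m : R := - pos (X - m%:R * w) ^+ k.+1.
  have -> : c * X ^+ k.+1 = \sum_(0 <= m < T.+1) c * (f m.+1 - f m).
    rewrite -mulr_sumr telescope_sumr// /f mul0r subr0 opprK (ger0_pos (ltW X0)).
    rewrite ler0_pos ?expr0n ?oppr0 ?add0r// subr_le0 -ler_pdivrMr// ltW//.
    by have /andP[_] := truncn_itv (divr_ge0 (ltW X0) (ltW w0)).
  rewrite !big_nat; apply: ler_sum => m /andP[_]; rewrite ltnS => mT.
  have mX : 0 <= X - m%:R * w.
    rewrite subr_ge0 -ler_pdivlMr//; have /andP[h _] := truncn_itv (divr_ge0 (ltW X0) (ltW w0)).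
    by apply: le_trans h; rewrite ler_nat.
  apply: le_trans (low _ mX); rewrite /f opprK addrC (ger0_pos mX).
  by rewrite -natr1 mulrDl mul1r opprD addrA.
have up Y : 0 <= Y -> (size (simplex_points ws Y))%:R <=
      c * ((Y + O' + w) ^+ k.+1 - (Y + O') ^+ k.+1).
  rewrite le_eqVlt => /orP[/eqP <-|Y0].
    rewrite simplex_points0// mulr_ge0// subr_ge0 lerXn2r ?nnegrE ?addr_ge0 ?(ltW w0)//.
    by rewrite lerDl ltW.
  have [_ /(_ Y0) h] := IHws Y ws0; apply: le_trans h _; rewrite -/c' c'E.
  rewrite -mulrA ler_wpM2l//.
  apply: le_trans _ (@subrXX_ge _ k (Y + O' + w) (Y + O') _); first by rewrite [_ + w - _]addrAC subrr add0r.
  by rewrite addr_ge0 ?(ltW Y0)//= lerDl ltW.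
pose f m : R := - (X - m%:R * w + O' + w) ^+ k.+1.
apply: (@le_trans _ _ (\sum_(0 <= m < T.+1) c * (f m.+1 - f m))).
  rewrite !big_nat; apply: ler_sum => m /andP[_]; rewrite ltnS => mT.
  have mX : 0 <= X - m%:R * w.
    rewrite subr_ge0 -ler_pdivlMr//; have /andP[h _] := truncn_itv (divr_ge0 (ltW X0) (ltW w0)).
    by apply: le_trans h; rewrite ler_nat.
  apply: le_trans (up _ mX) _; rewrite /f opprK [X in _ <= c * X]addrC.
  by rewrite -natr1 mulrDl mul1r opprD addrA -[_ - w + O']addrAC subrK.
rewrite -mulr_sumr telescope_sumr// ler_wpM2l// /f mul0r subr0 opprK big_cons -/O'.
rewrite [w + O']addrC addrA gerDr oppr_le0 exprn_ge0//.
have : T%:R * w <= X.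
  by rewrite -ler_pdivlMr//; have /andP[] := truncn_itv (divr_ge0 (ltW X0) (ltW w0)).
by rewrite -natr1 mulrDl mul1r => h; lra.
Qed.

End SimplexCount.

(** * Extension of approximately Lipschitz data *)

(** The formula of McShane, inf over t of p t + D x (pt t), with the error added to the data:
    it is Lipschitz as an infimum of Lipschitz functions, and on the data the approximate
    Lipschitz bound keeps it above p - err. *)
Lemma mcshane_approx (R : realType) (T X : Type) (D : X -> X -> R) (pt : T -> X)
    (p err : T -> R) (m : R) (t0 : T) :
  (forall x y, 0 <= D x y) -> (forall x, D x x = 0) ->
  (forall x y, D x y = D y x) ->
  (forall x y z, D x z <= D x y + D y z) ->
  (forall t, m <= p t) -> (forall t, 0 <= err t) ->
  (forall t t', `|p t - p t'| <= D (pt t) (pt t') + err t + err t') ->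
  exists g : X -> R, (forall x y, `|g x - g y| <= D x y) /\
    forall t, `|g (pt t) - p t| <= err t.
Proof.
move=> D0 Dxx Dsym Dtri pm err0 pD.
pose A x : set R := [set p t + D x (pt t) + err t | t in setT].
have Alb x : has_lbound (A x).
  exists m => _ [t _ <-]; rewrite -addrA (le_trans (pm t))// lerDl.
  by rewrite addr_ge0.
have A0 x : A x !=set0 by exists (p t0 + D x (pt t0) + err t0), t0.
have gle x y : inf (A x) <= inf (A y) + D x y.
  rewrite -lerBlDr; apply: lb_le_inf => // _ [t _ <-]; rewrite lerBlDr.
  apply: le_trans (ge_inf (Alb x) _) _; first by exists t.
  by have := Dtri x y (pt t); lra.
exists (fun x => inf (A x)); split=> [x y|t].
  have := gle x y; have := gle y x; rewrite (Dsym y x) ler_norml => h1 h2.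
  by apply/andP; split; lra.
have h1 : inf (A (pt t)) <= p t + err t.
  apply: le_trans (ge_inf (Alb _) _) _; first by exists t.
  by rewrite Dxx addr0.
have h2 : p t - err t <= inf (A (pt t)).
  apply: lb_le_inf => // _ [t' _ <-].
  by have := pD t t'; rewrite ler_norml => /andP[_]; lra.
by rewrite ler_norml; apply/andP; split; lra.
Qed.

Section SimplexRetraction.
Context (R : realType) (J : nat) (j0 : 'I_J).
Implicit Types (q : 'I_J -> R) (e : R).

Definition pos_mass q : R := \sum_j pos (q j).

(** Positive parts are divided by their sum when it exceeds 1; when it is below 1 the missing
    mass goes to the coordinate j0.  Both operations stay Lipschitz near sum 0, where the plain
    normalization is not. *)
Definition simplex_retract q (j : 'I_J) : R :=
  pos (q j) / Num.max (pos_mass q) 1 +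
  (j == j0)%:R * (1 - Num.min (pos_mass q) 1).

Let max_gt0 q : 0 < Num.max (pos_mass q) 1.
Proof. by rewrite lt_max ltr01 orbT. Qed.

Lemma simplex_retract_ge0 q j : 0 <= simplex_retract q j.
Proof.
rewrite addr_ge0// ?divr_ge0 ?pos_ge0 ?(ltW (max_gt0 q))//.
by rewrite mulr_ge0// subr_ge0 ge_min lexx orbT.
Qed.

Lemma sum_simplex_retract q : \sum_j simplex_retract q j = 1.
Proof.
rewrite big_split /= -mulr_suml -/(pos_mass q) -mulr_suml.
rewrite (bigD1 j0)//= eqxx big1 => [|j /negPf ->//]; rewrite addr0 mul1r.
case: (leP (pos_mass q) 1) => s1; first by rewrite divr1 addrC subrK.
by rewrite divff ?subrr ?addr0// gt_eqF// (lt_trans ltr01).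
Qed.

Lemma simplex_retract_id q : (forall j, 0 <= q j) -> \sum_j q j = 1 ->
  forall j, simplex_retract q j = q j.
Proof.
move=> q0 q1 j; have m1 : pos_mass q = 1.
  by rewrite -q1; apply: eq_bigr => i _; rewrite ger0_pos.
by rewrite /simplex_retract m1 maxxx minxx subrr mulr0 addr0 divr1 ger0_pos.
Qed.

Lemma simplex_retract_lip q q' e : (forall j, `|q j - q' j| <= e) ->
  forall j, `|simplex_retract q j - simplex_retract q' j| <= (1 + J%:R *+ 2) * e.
Proof.
move=> qe j; have e0 : 0 <= e := le_trans (normr_ge0 _) (qe j).
have pe i : `|pos (q i) - pos (q' i)| <= e := le_trans (pos_lip _ _) (qe i).
have me : `|pos_mass q - pos_mass q'| <= J%:R * e.
  rewrite /pos_mass -sumrB; apply: le_trans (ler_norm_sum _ _ _) _.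
  apply: (@le_trans _ _ (\sum_(i < J) e)); first by apply: ler_sum => i _.
  by rewrite sumr_const card_ord mulr_natl.
set s := pos_mass q in me *; set s' := pos_mass q' in me *.
have B0 : 0 <= J%:R * e by rewrite mulr_ge0.
have maxl : `|Num.max s 1 - Num.max s' 1| <= J%:R * e.
  move: me; rewrite !ler_norml !maxEle; move: s s' (J%:R * e) B0 => s s' B B0 /andP[h1 h2].
  by apply/andP; case: (leP s 1) => ?; case: (leP s' 1) => ?; split; lra.
have minl : `|Num.min s 1 - Num.min s' 1| <= J%:R * e.
  move: me {maxl}; rewrite !ler_norml !minEle; move: s s' (J%:R * e) B0 => s s' B B0 /andP[h1 h2].
  by apply/andP; case: (leP s 1) => ?; case: (leP s' 1) => ?; split; lra.
have M0 := max_gt0 q; have M'0 := max_gt0 q'; rewrite -/s -/s' in M0 M'0.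
have M1 : 1 <= Num.max s 1 by rewrite le_max lexx orbT.
have qM : pos (q' j) <= Num.max s' 1.
  rewrite le_max; apply/orP; left; rewrite /s' /pos_mass (bigD1 j)//= lerDl.
  by apply: sumr_ge0 => i _; exact: pos_ge0.
(* The first two terms come from changing the numerator and then the denominator. *)
have -> : simplex_retract q j - simplex_retract q' j =
   (pos (q j) - pos (q' j)) / Num.max s 1 +
   (pos (q' j) / Num.max s' 1) * ((Num.max s' 1 - Num.max s 1) / Num.max s 1) +
   (j == j0)%:R * (Num.min s' 1 - Num.min s 1).
  rewrite /simplex_retract -/s -/s'; field.
  by rewrite !gt_eqF.
have h1 : `|(pos (q j) - pos (q' j)) / Num.max s 1| <= e.
  rewrite normrM normfV (gtr0_norm M0) ler_pdivrMr//.
  by apply: le_trans (pe j) _; rewrite ler_peMr.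
have h2 : `|(pos (q' j) / Num.max s' 1) * ((Num.max s' 1 - Num.max s 1) / Num.max s 1)|
    <= J%:R * e.
  rewrite normrM -[leRHS]mul1r ler_pM//.
    by rewrite ger0_norm ?divr_ge0 ?pos_ge0 ?(ltW M'0)// ler_pdivrMr// mul1r.
  rewrite normrM normfV (gtr0_norm M0) ler_pdivrMr// distrC.
  by apply: le_trans maxl _; rewrite ler_peMr// mulr_ge0.
have h3 : `|(j == j0)%:R * (Num.min s' 1 - Num.min s 1)| <= J%:R * e.
  rewrite normrM distrC -[leRHS]mul1r ler_pM//.
  by rewrite normr_nat; case: (j == j0); rewrite ?ler01.
apply: le_trans (ler_normD _ _) _.
have := ler_normD ((pos (q j) - pos (q' j)) / Num.max s 1) ((pos (q' j) / Num.max s' 1) * ((Num.max s' 1 - Num.max s 1) / Num.max s 1)).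
by move: (J%:R) h1 h2 h3 => t; lra.
Qed.

End SimplexRetraction.

(** * Modulus and phase of complex numbers *)

Section ComplexModulus.
Context (R : realType).
Implicit Types z : R[i].

(** The norm of R[i] takes its values in R[i]; estimates need it in R. *)
Definition cabs z : R := ComplexField.Normc.normc z.

Lemma cabs_ge0 z : 0 <= cabs z.
Proof. by case: z => a b; exact: sqrtr_ge0. Qed.

Lemma cabs_eq0 z : (cabs z == 0) = (z == 0).
Proof.
apply/eqP/eqP => [|->]; first exact: ComplexField.Normc.eq0_normc.
exact: ComplexField.Normc.normc0.
Qed.

Lemma cabs_gt0 z : (0 < cabs z) = (z != 0).
Proof. by rewrite lt_def cabs_eq0 cabs_ge0 andbT. Qed.

Lemma cabs0 : cabs 0 = 0.
Proof. by apply/eqP; rewrite cabs_eq0. Qed.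

Lemma cabs1 : cabs 1 = 1.
Proof. exact: ComplexField.Normc.normc1. Qed.

Lemma cabsM z z' : cabs (z * z') = cabs z * cabs z'.
Proof. exact: ComplexField.Normc.normcM. Qed.

Lemma cabsV z : cabs z^-1 = (cabs z)^-1.
Proof. exact: ComplexField.Normc.normcV. Qed.

Lemma cabsN z : cabs (- z) = cabs z.
Proof. exact: normcN. Qed.

Lemma cabsD z z' : cabs (z + z') <= cabs z + cabs z'.
Proof. exact: le_normcD. Qed.

Lemma cabsB z z' : cabs (z - z') = cabs (z' - z).
Proof. by rewrite -cabsN opprB. Qed.

Lemma cabs_real (x : R) : cabs x%:C%C = `|x|.
Proof. by rewrite /cabs /= expr0n addr0 sqrtr_sqr. Qed.

Lemma cabs_sum (I : Type) (r : seq I) (P : pred I) (F : I -> R[i]) :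
  cabs (\sum_(i <- r | P i) F i) <= \sum_(i <- r | P i) cabs (F i).
Proof.
elim/big_rec2: _ => [|i y1 y2 _ IH]; first by rewrite cabs0.
by apply: le_trans (cabsD _ _) _; rewrite lerD2l.
Qed.

Lemma cabs_prod (I : Type) (r : seq I) (P : pred I) (F : I -> R[i]) :
  cabs (\prod_(i <- r | P i) F i) = \prod_(i <- r | P i) cabs (F i).
Proof.
by elim/big_rec2: _ => [|i y1 y2 _ IH]; rewrite ?cabs1// cabsM IH.
Qed.

Lemma cabsXz z (m : int) : cabs (z ^ m) = cabs z ^ m.
Proof.
have cabsX n : cabs (z ^+ n) = cabs z ^+ n.
  by elim: n => [|n IHn]; rewrite ?cabs1// !exprS cabsM IHn.
by case: m => n; [exact: cabsX | rewrite NegzE -!exprnN cabsV cabsX].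
Qed.

Lemma ratr_complex (q : rat) : ratr q = (ratr q : R)%:C%C.
Proof. exact/esym/(fmorph_rat (real_complex R)). Qed.

End ComplexModulus.

Arguments cabs {R} z : simpl never.

Lemma ln_prod (R : realType) (I : Type) (r : seq I) (F : I -> R) :
  (forall i, 0 < F i) -> ln (\prod_(i <- r) F i) = \sum_(i <- r) ln (F i).
Proof.
move=> F0; elim: r => [|i r IHr]; first by rewrite !big_nil ln1.
by rewrite !big_cons lnM ?IHr// posrE// prodr_gt0.
Qed.

Lemma ln_exprz (R : realType) (x : R) (m : int) : 0 < x -> ln (x ^ m) = m%:~R * ln x.
Proof.
move=> x0; case: m => n.
  by rewrite -pmulrn lnXn// mulr_natl.
by rewrite NegzE -exprnN lnV ?posrE ?exprn_gt0// lnXn// mulrNz -pmulrn mulNr mulr_natl.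
Qed.

Section Phase.
Local Open Scope quotient_scope.
Context (R : realType).
Implicit Types (x y : R) (z : R[i]).

Definition cis x : R[i] := (cos x +i* sin x)%C.

Lemma cis0 : cis 0 = 1.
Proof. by rewrite /cis cos0 sin0. Qed.

Lemma cisD x y : cis (x + y) = cis x * cis y.
Proof.
apply/eqP; rewrite eq_complex /=; apply/andP; split; apply/eqP.
  by rewrite cosD.
by rewrite sinD addrC.
Qed.

Lemma cabs_cis x : cabs (cis x) = 1.
Proof. by rewrite /cabs /= cos2Dsin2 sqrtr1. Qed.

Lemma cisN x : cis (- x) = (cis x)^-1.
Proof.
have c0 : cis x != 0 by rewrite -cabs_eq0 cabs_cis oner_eq0.
by apply: (mulfI c0); rewrite -cisD subrr cis0 divff.
Qed.

Lemma cis_int (m : int) : cis (2 * pi * m%:~R) = 1.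
Proof.
have cis_nat n : cis (2 * pi * n%:R) = 1.
  elim: n => [|n IHn]; first by rewrite mulr0 cis0.
  rewrite -[n.+1%:R]natr1 mulrDr cisD IHn mul1r mulr1 mulr_natl.
  by rewrite /cis cos2pi sin2pi.
case: m => n; first exact: cis_nat.
by rewrite NegzE mulrNz mulrN cisN cis_nat invr1.
Qed.

Lemma cabs_le x y : cabs (x +i* y)%C <= `|x| + `|y|.
Proof.
rewrite /cabs /=.
rewrite -(ler_sqr (x := Num.sqrt _)) ?nnegrE ?sqrtr_ge0 ?addr_ge0//.
rewrite sqr_sqrtr ?addr_ge0 ?sqr_ge0// sqrrD !real_normK ?num_real//.
by rewrite addrAC lerDl mulrn_wge0// mulr_ge0.
Qed.

Lemma cis_lip x y : cabs (cis x - cis y) <= 2 * `|x - y|.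
Proof.
wlog xy : x y / x <= y.
  move=> H; case/orP: (le_total x y) => /H//.
  by rewrite cabsB distrC.
have -> : cis x - cis y = ((cos x - cos y) +i* (sin x - sin y))%C by [].
apply: le_trans (cabs_le _ _) _; rewrite mulr_natl mulr2n.
have mvt (f df : R -> R) : (forall t : R, is_derive t 1 f (df t)) -> (forall t, `|df t| <= 1) ->
    `|f x - f y| <= `|x - y|.
  move=> fd df1; have [t _ fE] := @MVT_segment R f df x y xy (fun t _ => fd t)
    (derivable_within_continuous (fun t _ => @ex_derive _ _ _ _ _ _ _ (fd t))).
  by rewrite distrC fE normrM distrC ler_piMl.
apply: lerD.
  by apply: (mvt cos (fun t => - sin t)) => t; rewrite ?normrN; exact: sin_max.
by apply: (mvt sin cos) => t; exact: cos_max.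
Qed.

Lemma expR_lip (M x y : R) : x <= M -> y <= M -> `|expR x - expR y| <= expR M * `|x - y|.
Proof.
wlog xy : x y / x <= y.
  move=> H xM yM; case/orP: (le_total x y) => /H; first exact.
  by rewrite distrC [`|x - y|]distrC; apply.
move=> xM yM; rewrite distrC ger0_norm ?subr_ge0 ?ler_expR// distrC ger0_norm ?subr_ge0//.
have e : expR x = expR y * expR (x - y) by rewrite -expRD addrC subrK.
have := expR_ge1Dx (x - y) => h.
apply: (@le_trans _ _ (expR y * (y - x))).
  rewrite e -[X in X - _]mulr1 -mulrBr ler_wpM2l ?expR_ge0//; lra.
by rewrite ler_wpM2r ?subr_ge0// ler_expR.
Qed.

(** The argument x is not reduced modulo 2 pi, so that it is additive on products: this is what
    makes the phase of a product of powers linear in the exponents. *)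
Definition polar z x : Prop := z = (cabs z)%:C%C * cis x.

Lemma polar_exists z : exists x, polar z x.
Proof.
have [->|z0] := eqVneq z 0; first by exists 0; rewrite /polar cabs0 mul0r.
have c0 : 0 < cabs z by rewrite cabs_gt0.
case: z z0 c0 => a b z0; set r := cabs _ => r0.
have rE : a ^+ 2 + b ^+ 2 = r ^+ 2 by rewrite /r /cabs /= sqr_sqrtr// addr_ge0 ?sqr_ge0.
have abr : (a / r) ^+ 2 + (b / r) ^+ 2 = 1.
  by rewrite !expr_div_n -mulrDl rE divff// expf_neq0// gt_eqF.
have a1 : -1 <= a / r <= 1.
  rewrite -ler_norml -(ler_sqr (x := `|_|)) ?nnegrE// real_normK ?num_real// expr1n.
  by rewrite -abr lerDl sqr_ge0.
have cosE : cos (acos (a / r)) = a / r by rewrite acosK// in_itv.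
have sinE : sin (acos (a / r)) = `|b / r|.
  by rewrite sin_acos// -(sqrtr_sqr (b / r)) -abr addrC addKr.
have polarE x : cos x = a / r -> sin x = b / r -> polar (a +i* b)%C x.
  move=> cx sx; rewrite /polar -/r /cis cx sx; apply/eqP; rewrite eq_complex /=.
  have r_neq0 : r != 0 by rewrite gt_eqF.
  by rewrite !mul0r subr0 addr0 ![r * _]mulrC !divfK// !eqxx.
have [b0|b0] := leP 0 (b / r).
  by exists (acos (a / r)); apply: polarE; rewrite ?sinE ?ger0_norm.
by exists (- acos (a / r)); apply: polarE; rewrite ?cosN ?sinN ?sinE ?ltr0_norm// opprK.
Qed.

Lemma polar1 : polar 1 0.
Proof. by rewrite /polar cabs1 cis0 mulr1. Qed.

Lemma polarM z z' x x' : polar z x -> polar z' x' -> polar (z * z') (x + x').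
Proof. by move=> zE z'E; rewrite /polar {1}zE {1}z'E mulrACA -cisD cabsM rmorphM. Qed.

Lemma polarV z x : polar z x -> polar z^-1 (- x).
Proof. by move=> zE; rewrite /polar {1}zE invfM cisN cabsV fmorphV. Qed.

Lemma polarXz z x (m : int) : polar z x -> polar (z ^ m) (m%:~R * x).
Proof.
move=> zx; have pX n : polar (z ^+ n) (n%:R * x).
  elim: n => [|n IHn]; first by rewrite mul0r; exact: polar1.
  by rewrite exprS -nat1r mulrDl mul1r; exact: polarM.
case: m => n; first exact: pX.
by rewrite NegzE mulrNz mulNr -exprnN; apply/polarV/pX.
Qed.

Lemma polar_prod (I : Type) (r : seq I) (F : I -> R[i]) (x : I -> R) :
  (forall i, polar (F i) (x i)) ->
  polar (\prod_(i <- r) F i) (\sum_(i <- r) x i).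
Proof.
move=> Fx; elim: r => [|i r IHr]; first by rewrite !big_nil; exact: polar1.
by rewrite !big_cons; exact: polarM.
Qed.

(** The character of the circle is used to measure distances on the torus: it turns the
    quotient metric into a difference of complex numbers, for which the triangle inequality
    is at hand. *)
Definition circle_char (a : circle R) : R[i] := cis (2 * pi * repr a).

Lemma circle_charE x : circle_char (\pi_(circle R) x) = cis (2 * pi * x).
Proof.
have /circle_eqP/intrP[m mE] : \pi_(circle R) (repr (\pi_(circle R) x)) = \pi_(circle R) x.
  exact: reprK.
have -> : 2 * pi * x = 2 * pi * repr (\pi_(circle R) x) - 2 * pi * m%:~R.
  by rewrite -mE; ring.
by rewrite cisD cisN cis_int invr1 mulr1.
Qed.

(** The bound holds for every pair of representatives, hence for the infimum. *)
Lemma circle_char_lip (a b : circle R) :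
  cabs (circle_char a - circle_char b) <= 4 * pi * circle_dist a b.
Proof.
have pi0 : 0 < 4 * pi :> R by rewrite mulr_gt0// pi_gt0.
rewrite mulrC -ler_pdivrMr//; apply: lb_le_inf.
  by exists `|repr a - repr b|, (repr a); [exact: reprK|exists (repr b) => //; exact: reprK].
move=> _ [x <- [y <- <-]]; rewrite ler_pdivrMr// !circle_charE.
apply: le_trans (cis_lip _ _) _; rewrite -mulrBr normrM gtr0_norm ?mulr_gt0 ?pi_gt0//.
by rewrite le_eqVlt; apply/orP; left; apply/eqP; ring.
Qed.

End Phase.

(** * Embeddings of the number field *)

Section MultiplicationMatrix.
Context (d : nat) (Phi : fieldExtType rat) (bs : d.+1.-tuple Phi).
Hypothesis bsP : basis_of {:Phi}%VS bs.

Lemma coord_sum x : x = \sum_i coord bs i x *: bs`_i.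
Proof. exact: coord_basis bsP (memvf x). Qed.

Lemma coord_nth (i j : 'I_d.+1) : coord bs i bs`_j = (i == j)%:R.
Proof. by rewrite coord_free ?(basis_free bsP)// eq_sym. Qed.

(** The matrix of multiplication by x acting on row vectors of coordinates. *)
Definition mulmat (x : Phi) : 'M[rat]_d.+1 :=
  \matrix_(i, j) coord bs j (bs`_i * x).

Definition crow (x : Phi) : 'rV[rat]_d.+1 := \row_j coord bs j x.

Lemma crowM x y : crow (x * y) = crow x *m mulmat y.
Proof.
apply/rowP => j; rewrite !mxE {1}(coord_sum x) mulr_suml linear_sum.
by apply: eq_bigr => i _; rewrite -scalerAl linearZ !mxE.
Qed.

Lemma row_mulmat i x : row i (mulmat x) = crow (bs`_i * x).
Proof. by apply/rowP => j; rewrite !mxE. Qed.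

Lemma mulmatM x y : mulmat (x * y) = mulmat x *m mulmat y.
Proof. by apply/row_matrixP => i; rewrite row_mul !row_mulmat mulrA crowM. Qed.

Lemma mulmat1 : mulmat 1 = 1%:M.
Proof. by apply/matrixP => i j; rewrite !mxE mulr1 coord_nth eq_sym. Qed.

Lemma mulmat_is_linear : linear mulmat.
Proof.
move=> a x y; apply/matrixP => i j.
by rewrite !mxE mulrDr -scalerAr linearP.
Qed.

HB.instance Definition _ :=
  GRing.isLinear.Build rat Phi 'M[rat]_d.+1 _ mulmat mulmat_is_linear.

Lemma mulmat_is_monoid_morphism : monoid_morphism mulmat.
Proof. by split; [exact: mulmat1 | exact: mulmatM]. Qed.

HB.instance Definition _ :=
  GRing.isMonoidMorphism.Build Phi 'M[rat]_d.+1 mulmat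
    mulmat_is_monoid_morphism.

Lemma mulmat_unit x : x != 0 -> mulmat x \in unitmx.
Proof.
move=> x0; have: mulmat x *m mulmat x^-1 = 1%:M.
  by rewrite -mulmatM divff// mulmat1.
by case/mulmx1_unit.
Qed.

Section Embeddings.
Context (C : numClosedFieldType).

Lemma horner_mulmat x (q : {poly rat}) :
  horner_mx (mulmat x) q = mulmat (map_poly (GRing.in_alg Phi) q).[x].
Proof.
elim/poly_ind: q => [|q c IHq]; first by rewrite rmorph0 map_poly0 horner0 linear0.
rewrite rmorphD rmorphM /= horner_mx_X horner_mx_C IHq.
rewrite rmorphD rmorphM /= map_polyX map_polyC hornerD hornerMX hornerC.
by rewrite rmorphD rmorphM /= linearZ /= mulmat1 scalemx1.
Qed.

(** A separable polynomial over the rationals kills x, hence its multiplication matrix, and it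
    splits into distinct factors over C. *)
Lemma mulmat_diagonalizable x :
  diagonalizable (map_mx (ratr : rat -> C) (mulmat x)).
Proof.
have /separable_elementP[f [/polyOver1P[q ->] qx sepq]] :
  separable_element 1 x.
  apply: pcharf0_separable => p; rewrite -[RHS](pchar_num rat p).
  exact: (fmorph_pchar (GRing.in_alg Phi)).
have q0 : q != 0.
  by move: sepq; rewrite separable_map => /separable_poly_neq0.
apply/diagonalizableP.
pose qC := map_poly (ratr : rat -> C) q.
have [r qCE] := closed_field_poly_normal qC.
have qC0 : lead_coef qC != 0 by rewrite lead_coef_eq0 map_poly_eq0.
exists r.
  rewrite -separable_prod_XsubC -(eqp_separable (eqp_scale _ qC0)) -qCE.
  by rewrite separable_map; rewrite separable_map in sepq.
rewrite -(dvdpZr _ _ qC0) -qCE mxminpoly_map dvdp_map.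
by apply: mxminpoly_min; rewrite horner_mulmat (rootP qx) linear0.
Qed.

Lemma mulmat_codiagonalizable : exists2 P : 'M[C]_d.+1, P \in unitmx &
  forall x, is_diag_mx (P *m map_mx ratr (mulmat x) *m invmx P).
Proof.
pose As := [seq map_mx (ratr : rat -> C) (mulmat b) | b <- bs].
have [|P Pu Pd] := (codiagonalizableP As).1.
  split=> [_ _ /mapP[x _ ->] /mapP[y _ ->]|_ /mapP[x _ ->]].
    by rewrite /comm_mx -!map_mxM -!mulmatM mulrC.
  exact: mulmat_diagonalizable.
exists P => // x; rewrite [x]coord_sum linear_sum /= map_mx_sum /=.
rewrite mulmx_sumr mulmx_suml.
apply: (big_ind (@is_diag_mx _ _ _)) => [|A B|i _].
- exact: mx0_is_diag.
- move=> /is_diag_mxP A0 /is_diag_mxP B0; apply/is_diag_mxP => i j ij.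
  by rewrite !mxE A0// B0// addr0.
- rewrite linearZ /= map_mxZ -scalemxAr -scalemxAl.
  have /allP /(_ (map_mx ratr (mulmat bs`_i))) := Pd.
  rewrite /= /similar_to conjumx// => /(_ _)/is_diag_mxP A0.
  have {}A0 := A0 (map_f (fun b => map_mx ratr (mulmat b)) (mem_nth 0 _)).
  rewrite size_tuple in A0; have {}A0 := A0 (ltn_ord i). apply/is_diag_mxP => k l kl.
  by rewrite mxE A0// mulr0.
Qed.

(** The multiplication matrices commute, so they are diagonal in a common basis; their diagonal
    entries are the embeddings of Phi.  In this basis the determinant is the product of the
    embeddings, and the coordinates of x, which are those of 1 multiplied by the matrix of x,
    are linear in the embeddings of x.  Any embedding io occurs among them because the vector
    of the io bs`_i is a common eigenvector with eigenvalue io x. *)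
Theorem exists_embeddings : exists sg : 'I_d.+1 -> {rmorphism Phi -> C},
  [/\ exists A : 'M[C]_d.+1, forall x j,
        ratr (coord bs j x) = \sum_l A l j * sg l x,
      forall x, ratr (\det (mulmat x)) = \prod_l sg l x &
      forall io : {rmorphism Phi -> C}, exists k, forall x, io x = sg k x].
Proof.
have [P Pu Pd] := mulmat_codiagonalizable.
pose D x : 'M[C]_d.+1 := P *m map_mx ratr (mulmat x) *m invmx P.
have DE x : D x = diag_mx (\row_l D x l l).
  apply/matrixP => i j; rewrite [RHS]mxE; have [->|ij] := eqVneq i j.
    by rewrite [in RHS]mxE.
  by move/is_diag_mxP: (Pd x) => /(_ i j ij) ->.
have DP x : D x *m P = P *m map_mx ratr (mulmat x) by rewrite mulmxKV.
have DM x y : D (x * y) = D x *m D y.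
  by rewrite /D mulmatM map_mxM !mulmxA mulmxKV.
have DB x y : D (x - y) = D x - D y.
  by rewrite /D raddfB /= map_mxB mulmxBr mulmxBl.
have D1 : D 1 = 1%:M by rewrite /D mulmat1 map_mx1 mulmx1 mulmxV.
have Ddet x : \det (D x) = ratr (\det (mulmat x)).
  rewrite -det_map_mx -[RHS]mulr1 -(det1 C d.+1) -(mulmxV Pu).
  by rewrite /D !det_mulmx mulrCA mulrA.
clearbody D.
pose sg0 (l : 'I_d.+1) (x : Phi) : C := D x l l.
have sg0B l : zmod_morphism (sg0 l).
  by move=> x y; rewrite /sg0 DB !mxE.
have sg0M l : monoid_morphism (sg0 l).
  split; rewrite /sg0; first by rewrite D1 mxE eqxx.
  by move=> x y; rewrite DM [D x]DE [D y]DE mulmx_diag !mxE eqxx !mulr1n.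
pose sgA l := GRing.isZmodMorphism.Build Phi C (sg0 l) (sg0B l).
pose sgM l := GRing.isMonoidMorphism.Build Phi C (sg0 l) (sg0M l).
pose sg l : {rmorphism Phi -> C} := HB.pack (sg0 l) (sgA l) (sgM l).
have sgE l x : sg l x = D x l l by [].
clearbody sg.
exists sg; split.
(* crow x = crow 1 *m mulmat x, and mulmat x is diagonalized by P. *)
- pose a := map_mx ratr (crow 1) *m invmx P : 'rV[C]_d.+1.
  exists (\matrix_(l, j) (a 0 l * P l j)) => x j.
  have : map_mx ratr (crow x) = a *m D x *m P.
    by rewrite -mulmxA DP mulmxA mulmxKV// -map_mxM -crowM mul1r.
  move=> /rowP /(_ j); rewrite [LHS]mxE [X in ratr X]mxE => ->.
  rewrite mxE; apply: eq_bigr => l _.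
  rewrite [D x]DE mul_mx_diag [in LHS]mxE [X in _ * X * _]mxE [in RHS]mxE sgE.
  by rewrite mulrAC.
- move=> x; rewrite -Ddet DE det_diag.
  by apply: eq_bigr => l _; rewrite mxE sgE.
(* v is an eigenvector of all the matrices, so P *m v is one of all the diagonal ones;
   a nonzero entry of P *m v selects the embedding. *)
- move=> io; pose v : 'cV[C]_d.+1 := \col_i io bs`_i.
  have Mv x : map_mx ratr (mulmat x) *m v = io x *: v.
    apply/colP => i; rewrite !mxE -rmorphM [x * _]mulrC [in RHS](coord_sum (_ * x)).
    rewrite rmorph_sum; apply: eq_bigr => j _.
    by rewrite !mxE rmorphZ_num.
  have v0 : P *m v != 0.
    apply/eqP => /(congr1 (mulmx (invmx P))); rewrite mulKmx// mulmx0 => v0.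
    have /eqP := oner_eq0 C; apply.
    rewrite -(rmorph1 io) [X in io X]coord_sum rmorph_sum big1// => j _.
    by move/colP: v0 => /(_ j); rewrite !mxE rmorphZ_num => ->; rewrite mulr0.
  have Dv x : D x *m (P *m v) = io x *: (P *m v).
    by rewrite mulmxA DP -mulmxA Mv -scalemxAr.
  move: (P *m v) v0 Dv => {Mv}v v0 Dv.
  have [k vk] : exists k, v k 0 != 0.
    apply/existsP; apply: contraNT v0 => /existsPn vz; apply/eqP/colP => k.
    by rewrite [RHS]mxE; apply/eqP; rewrite -[_ == _]negbK.
  exists k => x; apply: (mulIf vk); rewrite sgE.
  have /colP /(_ k) := Dv x; rewrite [D x in LHS]DE mul_diag_mx.
  by rewrite [LHS]mxE [RHS]mxE [X in X * _]mxE => <-.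
Qed.

End Embeddings.

(** * The lattice and its units *)

Definition lattice : {pred Phi} :=
  fun x => [forall j, coord bs j x \is a Num.int].

Lemma latticeP x : reflect (forall j, coord bs j x \is a Num.int) (x \in lattice).
Proof. by rewrite unfold_in; exact: forallP. Qed.

Lemma lattice_zmod_closed : zmod_closed lattice.
Proof.
split=> [|x y /latticeP xL /latticeP yL]; apply/latticeP => j.
  by rewrite linear0 int_num0.
by rewrite linearB; exact: rpredB (xL j) (yL j).
Qed.

HB.instance Definition _ :=
  GRing.isZmodClosed.Build Phi lattice lattice_zmod_closed.

(** The ring of multipliers of the lattice.  The lattice itself need not be stable under
    products. *)
Definition multiplier : {pred Phi} :=
  fun x => mulmat x \is a mxOver (@Num.int rat).

Lemma multiplierP x :
  reflect (exists B : 'M[int]_d.+1, mulmat x = map_mx intr B) (x \in multiplier).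
Proof.
apply: (iffP mxOverP) => [xO|[B ->] i j]; last by rewrite mxE intr_int.
by exists (map_mx numq (mulmat x)); apply/matrixP => i j; rewrite [RHS]mxE [X in X%:~R]mxE numqK.
Qed.

Lemma multiplier_subring_closed : subring_closed multiplier.
Proof.
split=> [|x y /multiplierP[A xA] /multiplierP[B yB]|
         x y /multiplierP[A xA] /multiplierP[B yB]]; apply/multiplierP.
- by exists 1%:M; rewrite mulmat1 map_mx1.
- by exists (A - B); rewrite raddfB /= xA yB map_mxB.
- by exists (A *m B); rewrite mulmatM xA yB map_mxM.
Qed.

HB.instance Definition _ :=
  GRing.isSubringClosed.Build Phi multiplier multiplier_subring_closed.

Lemma latticeM x y : x \in lattice -> y \in multiplier -> x * y \in lattice.
Proof.
move=> /latticeP xL yO; apply/latticeP => j.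
have -> : coord bs j (x * y) = crow (x * y) 0 j by rewrite mxE.
have: crow x *m mulmat y \is a mxOver (@Num.int rat).
  by apply: mxOverM => //; apply/mxOverP => i i'; rewrite mxE.
by rewrite crowM => /mxOverP.
Qed.

Lemma multiplier_int (N : rat) x :
  N \is a Num.int -> x \in multiplier -> N *: x \in multiplier.
Proof.
move=> NZ; rewrite !unfold_in => xO; rewrite linearZ /=.
by apply/mxOverP => i j; rewrite mxE rpredM//; apply: (mxOverP xO).
Qed.

Lemma det_mulmat_int x : x \in multiplier -> \det (mulmat x) \is a Num.int.
Proof. by move=> /multiplierP[B ->]; rewrite det_map_mx intr_int. Qed.

Lemma det_mulmat_neq0 x : x != 0 -> \det (mulmat x) != 0.
Proof. by move=> /mulmat_unit; rewrite unitmxE unitfE. Qed.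

(** The matrix of N / x, with N the determinant, is the adjugate of the matrix of x. *)
Lemma multiplier_norm_inv x :
  x \in multiplier -> \det (mulmat x) *: x^-1 \in multiplier.
Proof.
have [->|x0 xO] := eqVneq x 0; first by rewrite invr0 scaler0 rpred0.
have : mulmat (\det (mulmat x) *: x^-1) = \adj (mulmat x).
  apply: (can_inj (mulKmx (mulmat_unit x0))).
  by rewrite -mulmatM -scalerAr divff// linearZ /= mulmat1 scalemx1 mul_mx_adj.
move=> adjE; apply/multiplierP; have /multiplierP[B xB] := xO.
by exists (\adj B); rewrite adjE xB map_mx_adj.
Qed.

(** A common denominator of the structure constants works. *)
Lemma exists_conductor :
  exists2 D : nat, (0 < D)%N & forall x, x \in lattice -> D%:R *: x \in multiplier.
Proof.
pose c (p : 'I_d.+1 * 'I_d.+1 * 'I_d.+1) := coord bs p.2 (bs`_p.1.1 * bs`_p.1.2).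
pose D := \prod_p `|denq (c p)|%N.
have D0 : (0 < D)%N by rewrite prodn_gt0// => p; rewrite absz_gt0 denq_neq0.
exists D => // x /latticeP xL; apply/mxOverP => i k; rewrite mxE.
rewrite -scalerAr linearZ /= {1}(coord_sum x) mulr_sumr linear_sum mulr_sumr /=.
apply: rpred_sum => j _; rewrite -scalerAr linearZ /= mulrCA rpredM//.
rewrite /D (bigD1 (i, j, k))//= natrM mulrAC rpredM ?rpred_nat//.
rewrite /c /= natr_absz ger0_norm ?denq_ge0//.
by rewrite mulrC -numqE intr_int.
Qed.

(** Units of the multiplier ring; multiplication by such an element permutes the lattice. *)
Definition lattice_unit (x : Phi) : bool :=
  [&& x != 0, x \in multiplier & x^-1 \in multiplier].

Lemma lattice_unitV x : lattice_unit x -> lattice_unit x^-1.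
Proof. by case/and3P=> x0 xO xVO; rewrite /lattice_unit invr_eq0 x0 invrK xVO. Qed.

Lemma lattice_unit1 : lattice_unit 1.
Proof. by rewrite /lattice_unit oner_eq0 invr1 rpred1. Qed.

Lemma lattice_unitM x y : lattice_unit x -> lattice_unit y -> lattice_unit (x * y).
Proof.
move=> /and3P[x0 xO xVO] /and3P[y0 yO yVO].
by rewrite /lattice_unit mulf_neq0// invfM !rpredM.
Qed.

Lemma lattice_unitXz x (m : int) : lattice_unit x -> lattice_unit (x ^ m).
Proof.
move=> ux; have uX n : lattice_unit (x ^+ n).
  elim: n => [|n IHn]; first exact: lattice_unit1.
  by rewrite exprS lattice_unitM.
case: m => n; first exact: uX.
exact/lattice_unitV/uX.
Qed.

Lemma lattice_unitN x : lattice_unit x -> lattice_unit (- x).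
Proof. by rewrite /lattice_unit oppr_eq0 invrN !rpredN. Qed.

Lemma lattice_unit_det x : lattice_unit x -> `|\det (mulmat x)| = 1.
Proof.
case/and3P=> x0 xO xVO.
have : \det (mulmat x) * \det (mulmat x^-1) = 1.
  by rewrite -det_mulmx -mulmatM divff// mulmat1 det1.
have /intrP[a ->] := det_mulmat_int xO; have /intrP[b ->] := det_mulmat_int xVO.
rewrite -intrM => /eqP; rewrite (eqr_int _ _ 1) => /eqP ab1.
have /eqP : absz (a * b) = 1%N by rewrite ab1.
by rewrite abszM muln_eq1 => /andP[/eqP a1 _]; rewrite -intr_norm -abszE a1.
Qed.

(** If x and x' have bounded norm and are congruent modulo a multiple K of the norm of D x',
    then x / x' = 1 + (K / N) (D z) (N / (D x')) is a multiplier, and so is its inverse by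
    symmetry.  So there are at most as many x up to units as classes modulo K. *)
Lemma unit_representatives (B : rat) : exists (T : finType) (rep : T -> Phi),
  (forall c, rep c != 0) /\
  forall x, x \in lattice -> x != 0 -> `|\det (mulmat x)| <= B ->
    exists c, lattice_unit (x / rep c).
Proof.
have [D D0 DO] := exists_conductor.
(* A factorial is divisible by all the norms that can occur. *)
pose K := (Num.truncn (D%:R ^+ d.+1 * B))`!.
have K0 : (0 < K)%N by exact: fact_gt0.
pose good x := [/\ x \in lattice, x != 0 & `|\det (mulmat x)| <= B].
have goodN x : good x -> let N := \det (mulmat (D%:R *: x)) in
    N != 0 /\ K%:R / N \is a Num.int.
  move=> [xL x0 xB] N.
  have N0 : N != 0.
    by rewrite det_mulmat_neq0// scaler_eq0 negb_or x0 pnatr_eq0 -lt0n D0.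
  split=> //; have /intrP[m Nm] : N \is a Num.int by apply/det_mulmat_int/DO.
  have : `|N| <= D%:R ^+ d.+1 * B.
    by rewrite /N linearZ detZ normrM normrX normr_nat ler_wpM2l// exprn_ge0.
  rewrite Nm -intr_norm -abszE -[X in X%:~R]/(Posz (absz m)) => mB.
  have mK : (absz m %| K)%N.
    rewrite dvdn_fact//; apply/andP; split.
      by rewrite absz_gt0; apply: contraNneq N0 => m0; rewrite Nm m0.
    by rewrite truncn_ge_nat// (le_trans _ mB).
  have -> : (K%:R : rat) = (Posz K)%:~R by [].
  by rewrite Qint_dvdz// dvdzE.
pose cl x := [ffun j => inord (absz (numq (coord bs j x) %% K)%Z)] :
  {ffun 'I_d.+1 -> 'I_K.-1.+1}.
have clE x x' : x \in lattice -> x' \in lattice -> cl x = cl x' ->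
    K%:R^-1 *: (x - x') \in lattice.
  move=> /latticeP xL /latticeP x'L /ffunP clx; apply/latticeP => j.
  have := congr1 (@nat_of_ord _) (clx j); rewrite !ffunE.
  have KZ : (K : int) != 0 by rewrite -lt0n.
  have ltK (z : int) : (absz (z %% K)%Z < K.-1.+1)%N.
    by rewrite prednK// -ltz_nat gez0_abs ?modz_ge0// ltz_pmod.
  rewrite !inordK// => /(congr1 Posz); rewrite !gez0_abs ?modz_ge0// => /eqP.
  rewrite eqz_mod_dvd => /dvdzP[q qE].
  rewrite linearZ linearB /= -(numqK (xL j)) -(numqK (x'L j)) -intrB qE.
  by rewrite intrM mulrC mulfK ?intr_int// pnatr_eq0 -lt0n.
have quot x x' : good x -> good x' -> cl x = cl x' -> x / x' \in multiplier.
  move=> [xL x0 xB] gx' clx; have [x'L x'0 x'B] := gx'.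
  have := clE _ _ xL x'L clx; set z := _ *: _ => zL.
  have [N0 KN] := goodN _ gx'; set N := \det _ in N0 KN.
  have -> : x / x' = 1 + (K%:R / N) *: ((D%:R *: z) * (N *: (D%:R *: x')^-1)).
    have KQ : K%:R != 0 :> rat by rewrite pnatr_eq0 -lt0n.
    have DQ : D%:R != 0 :> rat by rewrite pnatr_eq0 -lt0n.
    rewrite -scalerAr scalerA mulfVK// -scalerAl invrZ ?unitfE// -scalerAr.
    rewrite (scalerA D%:R) divff// scale1r scalerAl scalerA divff// scale1r.
    by rewrite mulrBl divff// addrC subrK.
  rewrite rpredD ?rpred1// multiplier_int// rpredM ?DO//.
  exact/multiplier_norm_inv/DO.
pose rep c := if pselect (exists x, good x /\ cl x = c) is left e
  then projT1 (cid e) else 1.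
have repP x : good x -> good (rep (cl x)) /\ cl (rep (cl x)) = cl x.
  move=> gx; rewrite /rep; case: pselect => [e|[]]; last by exists x.
  by case: (cid e).
exists {ffun 'I_d.+1 -> 'I_K.-1.+1}, rep; split=> [c|x xL x0 xB].
  rewrite /rep; case: pselect => [e|_]; last exact: oner_neq0.
  by case: (cid e) => x [[]].
have gx : good x by [].
have [gr clr] := repP _ gx; exists (cl x).
have r0 : rep (cl x) != 0 by case: gr.
by rewrite /lattice_unit mulf_neq0 ?invr_eq0// quot//= invf_div quot.
Qed.

End MultiplicationMatrix.

(** * Units of prescribed size *)

Section Scaling.
Context (R : realType) (d : nat) (Phi : fieldExtType rat).
Context (iota : {rmorphism Phi -> R}) (bs : d.+1.-tuple Phi).
Hypothesis d_gt0 : (0 < d)%N.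
Hypothesis bsP : basis_of {:Phi}%VS bs.
Hypothesis bs_gt0 : forall i : 'I_d.+1, 0 < iota bs`_i.
Context (sg : 'I_d.+1 -> {rmorphism Phi -> R[i]}) (A : 'M[R[i]]_d.+1) (k0 : 'I_d.+1).
Hypothesis sg_coord : forall x j, ratr (coord bs j x) = \sum_l A l j * sg l x.
Hypothesis sg_norm : forall x, ratr (\det (mulmat bs x)) = \prod_l sg l x.
Hypothesis sg_k0 : forall x, (iota x)%:C%C = sg k0 x.

Local Notation co x j := (ratr (coord bs j x) : R).
Local Notation om j := (iota bs`_j).

Lemma iota_coord x : iota x = \sum_j co x j * om j.
Proof.
rewrite {1}(coord_sum bsP x) rmorph_sum; apply: eq_bigr => j _.
by rewrite rmorphZ_num.
Qed.

Definition absval l x : R := cabs (sg l x).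

Lemma absval_k0 x : absval k0 x = `|iota x|.
Proof. by rewrite /absval -sg_k0 cabs_real. Qed.

Lemma absval_gt0 l x : x != 0 -> 0 < absval l x.
Proof. by rewrite cabs_gt0 fmorph_eq0. Qed.

Lemma absvalM l x y : absval l (x * y) = absval l x * absval l y.
Proof. by rewrite /absval rmorphM cabsM. Qed.

Lemma absvalV l x : absval l x^-1 = (absval l x)^-1.
Proof. by rewrite /absval fmorphV cabsV. Qed.

Lemma absvalXz l x (m : int) : x != 0 -> absval l (x ^ m) = absval l x ^ m.
Proof. by move=> x0; rewrite /absval rmorphXz ?unitfE// cabsXz. Qed.

Lemma prod_absval x : \prod_l absval l x = `|ratr (\det (mulmat bs x))|.
Proof. by rewrite -cabs_prod -sg_norm ratr_complex cabs_real. Qed.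

Lemma prod_absval_unit u : lattice_unit bs u -> \prod_l absval l u = 1.
Proof. by move=> uU; rewrite prod_absval -ratr_norm (lattice_unit_det bsP uU) rmorph1. Qed.

Definition coord_cst : R := \sum_l \sum_j cabs (A l j).
Definition embed_cst : R := \sum_l \sum_(j < d.+1) absval l bs`_j.

Lemma coord_cst_ge0 : 0 <= coord_cst.
Proof. by apply: sumr_ge0 => l _; apply: sumr_ge0 => j _; exact: cabs_ge0. Qed.

Lemma embed_cst_ge0 : 0 <= embed_cst.
Proof. by apply: sumr_ge0 => l _; apply: sumr_ge0 => j _; exact: cabs_ge0. Qed.

Lemma coord_le x M j : (forall l, absval l x <= M) -> `|co x j| <= coord_cst * M.
Proof.
move=> xM; rewrite -cabs_real -ratr_complex sg_coord.
apply: le_trans (cabs_sum _ _ _) _; rewrite /coord_cst mulr_suml.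
apply: ler_sum => l _; rewrite cabsM ler_pM ?cabs_ge0//.
  by rewrite (bigD1 j)//= lerDl sumr_ge0// => i _; exact: cabs_ge0.
exact: xM.
Qed.

Lemma absval_le x M l : (forall j, `|co x j| <= M) -> absval l x <= embed_cst * M.
Proof.
move=> xM; have M0 : 0 <= M := le_trans (normr_ge0 _) (xM ord0).
rewrite /absval {1}(coord_sum bsP x) rmorph_sum.
apply: le_trans (cabs_sum _ _ _) _; rewrite /embed_cst [X in _ <= X * _](bigD1 l)//= mulrDl.
apply: ler_wpDr.
  by rewrite mulr_ge0// sumr_ge0// => i _; rewrite sumr_ge0// => j _; exact: cabs_ge0.
rewrite mulr_suml; apply: ler_sum => j _.
by rewrite rmorphZ_num cabsM ratr_complex cabs_real mulrC ler_wpM2l// cabs_ge0.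
Qed.

Definition freq_sum : R := \sum_(j < d.+1) om j.

Lemma freq_sum_gt0 : 0 < freq_sum.
Proof. by rewrite /freq_sum big_ord_recl ltr_pwDl// sumr_ge0// => i _; rewrite ltW. Qed.

(** Among the (Q + 1)^(d + 1) points with coordinates in 0..Q, two must have their values in
    the same one of Q^(d + 1) intervals dividing the range of iota. *)
Lemma small_lattice_point (Q : nat) : (0 < Q)%N -> exists x,
  [/\ x \in lattice bs, x != 0, forall j, `|co x j| <= Q%:R &
      `|iota x| <= (freq_sum + 1) / Q%:R ^+ d].
Proof.
move=> Q0; pose T := {ffun 'I_d.+1 -> 'I_Q.+1}.
pose pt (m : T) : Phi := \sum_j (m j)%:R *: bs`_j.
have coP (m : T) j : coord bs j (pt m) = (m j)%:R.
  rewrite linear_sum (bigD1 j)//= linearZ /= (coord_nth bsP) eqxx mulr1.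
  rewrite big1 ?addr0// => i ij; rewrite linearZ /= (coord_nth bsP).
  by rewrite eq_sym (negPf ij) mulr0.
have ioP m : iota (pt m) = \sum_j (m j)%:R * om j.
  by rewrite iota_coord; apply: eq_bigr => j _; rewrite coP ratr_nat.
(* The extra 1 in W makes the range half-open, so that the box number stays below M. *)
pose M := (Q ^ d.+1)%N; pose W : R := Q%:R * freq_sum + 1.
have W0 : 0 < W by rewrite ltr_pwDr// mulr_ge0// ltW// freq_sum_gt0.
have M0 : (0 < M)%N by rewrite expn_gt0 Q0.
have pt0 m : 0 <= iota (pt m).
  by rewrite ioP sumr_ge0// => j _; rewrite mulr_ge0// ltW.
have ptW m : iota (pt m) < W.
  rewrite ioP; apply: (@le_lt_trans _ _ (Q%:R * freq_sum)); last by rewrite ltrDl.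
  rewrite /freq_sum mulr_sumr; apply: ler_sum => j _.
  by apply: ler_wpM2r; [exact: ltW | rewrite ler_nat -ltnS].
pose box m : nat := Num.truncn (iota (pt m) * M%:R / W).
have box_lt m : (box m < M)%N.
  rewrite /box truncn_lt_nat ?divr_ge0 ?mulr_ge0// ?(ltW W0)//.
  by rewrite ltr_pdivrMr// mulrC ltr_pM2l ?ltr0n.
pose f (m : T) := Ordinal (box_lt m).
have /injectivePn[m [m' mm' fmm']] : ~~ injectiveb f.
  apply/negP => /injectiveP /leq_card; rewrite card_ffun !card_ord leqNgt.
  by rewrite /M ltn_exp2r// ltnSn.
have xco j : coord bs j (pt m - pt m') = (m j)%:R - (m' j)%:R.
  by rewrite linearB /= !coP.
exists (pt m - pt m'); split.
- apply/latticeP => j; rewrite xco.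
  by rewrite rpredB// rpred_nat.
- apply: contraNneq mm' => x0; apply/eqP/ffunP => j; apply/val_inj/eqP.
  have := xco j; rewrite x0 linear0 => /esym/eqP.
  by rewrite subr_eq0 eqr_nat.
- move=> j; rewrite xco rmorphB /= !ratr_nat ler_norml lerBrDr lerBlDr.
  have mQ (m1 : T) : (0 : R) <= (m1 j)%:R <= Q%:R.
    by rewrite ler0n ler_nat -ltnS ltn_ord.
  by have /andP[] := mQ R m; have /andP[] := mQ R m'; lra.
- have := congr1 val fmm'; rewrite /= /box => bE.
  have tP (y : R) : 0 <= y -> (Num.truncn y)%:R <= y < (Num.truncn y)%:R + 1.
    by move=> y0; rewrite natr1; exact: truncn_itv.
  have p0 m1 : 0 <= iota (pt m1) * M%:R / W.
    by rewrite divr_ge0 ?mulr_ge0// ltW.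
  have := tP _ (p0 m); have := tP _ (p0 m'); rewrite -bE => /andP[a1 a2] /andP[a3 a4].
  have : `|iota (pt m) * M%:R / W - iota (pt m') * M%:R / W| <= 1.
    by rewrite ler_norml; lra.
  rewrite -!mulrBl -rmorphB !normrM normfV (gtr0_norm W0) normr_nat.
  rewrite ler_pdivrMr// mul1r -ler_pdivlMr ?ltr0n// => /le_trans; apply.
  rewrite /M expnS natrM natrX invfM mulrA ler_wpM2r ?invr_ge0 ?exprn_ge0//.
  by rewrite ler_pdivrMr ?ltr0n// mulrDl mul1r mulrC lerD2l ler1n.
Qed.

(** The logarithms, divided by ln E, of the sizes E^d at the embedding k0, which is iota, and
    1/E at all the others. *)
Definition log_direction (l : 'I_d.+1) : R := if l == k0 then d%:R else -1.

Lemma sum_log_direction : \sum_l log_direction l = 0.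
Proof.
rewrite (bigD1 k0)//= {1}/log_direction eqxx (eq_bigr (fun=> -1)); last first.
  by move=> l /negPf lk; rewrite /log_direction lk.
by rewrite big_const_seq -/index_enum -big_const_seq sumr_const cardC1 card_ord mulNrn subrr.
Qed.

Lemma zero_sum_bound n (y : 'I_n -> R) (M : R) : 0 <= M ->
  \sum_l y l = 0 -> (forall l, - M <= y l) -> forall l, `|y l| <= n%:R * M.
Proof.
move=> M0 y0 yM l; have n0 : (0 < n)%N by case: n l {y y0 yM} => [[]|].
rewrite ler_norml; apply/andP; split.
  by apply: le_trans (yM l); rewrite lerN2 ler_peMl// ler1n.
have : 0 <= \sum_(i | i != l) (y i + M) by rewrite sumr_ge0// => i _; rewrite -lerBlDr sub0r.
move: y0; rewrite (bigD1 l)//= => /eqP; rewrite addr_eq0 => /eqP ->.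
rewrite big_split /= sumr_const cardC1 card_ord addrC -lerBlDr sub0r => /le_trans; apply.
by rewrite -[leLHS]mulr_natl ler_wpM2r// ler_nat leq_pred.
Qed.

(** The small lattice points have bounded norm, so they are units up to finitely many factors.
    This bounds the logarithms of u from one side, and the product formula bounds them from
    the other side. *)
Lemma unit_at_scale : exists Cu, forall Q : nat, (0 < Q)%N -> exists u,
  lattice_unit bs u /\ forall l, `|ln (absval l u) - log_direction l * ln Q%:R| <= Cu.
Proof.
pose B := Num.truncn ((freq_sum + 1) * embed_cst ^+ d).
have [T [rep [rep0 repP]]] := unit_representatives bsP B.+1%:R.
pose C1 := `|ln (freq_sum + 1)| + `|ln embed_cst|.
pose C2 := \sum_c \sum_l `|ln (absval l (rep c))|.
have C10 : 0 <= C1 by rewrite addr_ge0.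
have C20 : 0 <= C2 by apply: sumr_ge0 => c _; apply: sumr_ge0.
exists (d.+1%:R * (C1 + C2)) => Q Q0.
have QR : 0 < Q%:R :> R by rewrite ltr0n.
have [x [xL x0 xQ ix]] := small_lattice_point Q0.
have abx l : l != k0 -> absval l x <= embed_cst * Q%:R by move=> _; exact: absval_le.
have om1 : 0 < freq_sum + 1 by rewrite addr_gt0// freq_sum_gt0.
have [|c uc] := repP x xL x0.
  rewrite -(ler_rat R) ratr_norm -prod_absval (bigD1 k0)//= absval_k0.
  rewrite ratr_nat; apply: (@le_trans _ _ ((freq_sum + 1) * embed_cst ^+ d)).
    apply: (@le_trans _ _ ((freq_sum + 1) / Q%:R ^+ d * \prod_(l < d.+1 | l != k0) (embed_cst * Q%:R))).
      apply: ler_pM => //; first by apply: prodr_ge0 => l _; exact: cabs_ge0.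
      by apply: ler_prod => l lk; rewrite cabs_ge0 abx.
    rewrite prodr_const cardC1 card_ord /= exprMn mulrACA.
    by rewrite mulVf ?mulr1// expf_neq0// gt_eqF.
  by rewrite ltW// -truncn_lt_nat ?leqnn// mulr_ge0 ?exprn_ge0 ?embed_cst_ge0 ?(ltW om1).
exists (rep c / x); split; first by rewrite -invf_div; exact: lattice_unitV.
have r0 := rep0 c.
have lnE l : ln (absval l (rep c / x)) = ln (absval l (rep c)) - ln (absval l x).
  by rewrite absvalM absvalV ln_div// posrE absval_gt0.
apply: zero_sum_bound; first exact: addr_ge0.
  rewrite sumrB -mulr_suml sum_log_direction mul0r subr0 -ln_prod; last first.
    by move=> l; rewrite absval_gt0// mulf_neq0// invr_eq0.
  by rewrite prod_absval_unit ?ln1// -invf_div; exact: lattice_unitV.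
move=> l; rewrite lnE.
have h2 : - C2 <= ln (absval l (rep c)).
  rewrite lerNl (le_trans (ler_norm _))// normrN /C2 (bigD1 c)//= (bigD1 l)//=.
  rewrite -addrA lerDl addr_ge0// sumr_ge0// => i _; exact: sumr_ge0.
suff : ln (absval l x) <= C1 - log_direction l * ln Q%:R by lra.
have aln := absval_gt0 l x0.
rewrite /log_direction; case: eqVneq => [lk|lk].
  apply: (@le_trans _ _ (ln ((freq_sum + 1) / Q%:R ^+ d))).
    by rewrite ler_ln ?posrE ?divr_gt0 ?exprn_gt0// lk absval_k0.
  rewrite ln_div ?posrE ?exprn_gt0// lnXn// -[_ *+ d]mulr_natl lerD2r.
  by rewrite (le_trans (ler_norm _))// lerDl.
have e0 : 0 < embed_cst.
  by have := lt_le_trans aln (abx l lk); rewrite pmulr_lgt0.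
apply: (@le_trans _ _ (ln (embed_cst * Q%:R))).
  by rewrite ler_ln ?posrE ?mulr_gt0// abx.
rewrite lnM ?posrE// mulN1r opprK lerD2r.
by rewrite (le_trans (ler_norm _))// lerDr.
Qed.

(** Take units eta i whose logarithm vectors are linearly independent, in the largest possible
    number; all logarithm vectors lie in their span.  If the direction did not, a linear form
    vanishing on the span would be nonzero on it, while the units at scale Q are at bounded
    distance from ln Q times the direction: this is false for large Q.  Replacing eta i by its
    opposite makes iota (eta i) positive and keeps its absolute values. *)
Lemma scaling_units : exists (r : nat) (eta : 'I_r -> Phi) (b : 'I_r -> R),
  [/\ (r <= d.+1)%N, forall i, lattice_unit bs (eta i),
      forall i, 0 < iota (eta i) &
      forall l, \sum_i b i * ln (absval l (eta i)) = log_direction l].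
Proof.
pose lmx r (eta : 'I_r -> Phi) : 'M[R]_(r, d.+1) :=
  \matrix_(i, l) ln (absval l (eta i)).
pose P r := `[< exists eta : 'I_r -> Phi,
  (forall i, lattice_unit bs (eta i)) /\ row_free (lmx r eta) >].
have exP : exists r, P r.
  exists 0%N; apply/asboolP; exists (fun=> 1); split=> [[]//|].
  by rewrite /row_free -leqn0 rank_leq_row.
have leP r : P r -> (r <= d.+1)%N.
  by move=> /asboolP[eta [_ /eqP <-]]; exact: rank_leq_col.
case: (ex_maxnP exP leP) => r /asboolP[eta [etaU etaF]] rmax.
have sub u : lattice_unit bs u -> ((\row_l ln (absval l u)) <= lmx r eta)%MS.
  move=> uU; apply/negPn/negP => nsub.
  pose eta' (i : 'I_r.+1) := if unlift ord0 i is Some j then eta j else u.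
  suff /rmax : P r.+1 by rewrite ltnn.
  apply/asboolP; exists eta'; split=> [i|].
    by rewrite /eta'; case: unliftP => [j _|_].
  rewrite /row_free eqn_leq rank_leq_row /=.
  set w := \row_l _ in nsub.
  have : (lmx r eta < lmx r eta + w)%MS.
    rewrite ltmxE addsmxSl /=; apply: contra nsub; apply: submx_trans.
    exact: addsmxSr.
  move=> /rank_ltmx; rewrite (eqP etaF) => /leq_trans; apply.
  apply: mxrankS; rewrite addsmx_sub; apply/andP; split.
    apply/row_subP => j; suff -> : row j (lmx r eta) = row (lift ord0 j) (lmx r.+1 eta').
      exact: row_sub.
    by apply/rowP => l; rewrite !mxE /eta' liftK.
  suff -> : w = row ord0 (lmx r.+1 eta') by exact: row_sub.
  by apply/rowP => l; rewrite !mxE /eta' unlift_none.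
have vsub : ((\row_l log_direction l) <= lmx r eta)%MS.
  rewrite submxE; apply/negPn/negP => /eqP vN0.
  (* A column of the cokernel on which the direction does not vanish is the linear form. *)
  set K := cokermx _ in vN0.
  have [j cj] : exists j, (\row_l log_direction l *m K) 0 j != 0.
    apply/existsP; apply: contra_notT vN0 => /existsPn z; apply/rowP => j.
    by rewrite [RHS]mxE; apply/eqP; rewrite -[_ == _]negbK z.
  set c := (_ *m _) 0 j in cj.
  have [Cu CuP] := unit_at_scale.
  pose S := \sum_l Cu * `|K l j|.
  pose Q := (Num.truncn (expR (S / `|c|))).+1.
  have [u [uU uQ]] := CuP Q isT.
  have Su : ln Q%:R * `|c| <= S.
    have : (\row_l ln (absval l u) *m K) 0 j = 0.
      by have := sub _ uU; rewrite submxE => /eqP ->; rewrite mxE.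
    rewrite -[X in X * _]ger0_norm ?ln_ge0 ?ler1n// -normrM.
    have -> : ln Q%:R * c = \sum_l (log_direction l * ln Q%:R) * K l j.
      rewrite /c mxE mulr_sumr; apply: eq_bigr => l _; rewrite mxE.
      by rewrite mulrA [_ * log_direction l]mulrC.
    rewrite mxE => z0; rewrite -normrN -[- _]add0r -[X in `|X - _|]z0 -sumrB.
    apply: le_trans (ler_norm_sum _ _ _) _; apply: ler_sum => l _.
    by rewrite mxE -mulrBl normrM ler_wpM2r.
  have : ln (expR (S / `|c|)) < ln Q%:R.
    rewrite ltr_ln ?posrE ?expR_gt0 ?ltr0n// /Q -truncn_lt_nat ?expR_ge0 //.
  by rewrite expRK ltr_pdivrMr ?normr_gt0// ltNge Su.
have [D DE] := submxP vsub.
pose eta' i := if 0 < iota (eta i) then eta i else - eta i.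
have abE l i : absval l (eta' i) = absval l (eta i).
  by rewrite /eta'; case: ifP => // _; rewrite /absval rmorphN cabsN.
exists r, eta', (D 0); split=> [|i|i|l].
- by apply: leP; apply/asboolP; exists eta.
- by rewrite /eta'; case: ifP => // _; apply: lattice_unitN.
- rewrite /eta'; case: ifPn => //; rewrite -leNgt rmorphN oppr_gt0 le_eqVlt fmorph_eq0.
  by have /and3P[/negPf ->] := etaU i.
- have /rowP/(_ l) := DE; rewrite !mxE => ->; apply: eq_bigr => i _.
  by rewrite mxE abE.
Qed.

Section ScalingUnit.
Context (r : nat) (eta : 'I_r -> Phi) (b : 'I_r -> R).
Hypothesis etaU : forall i, lattice_unit bs (eta i).
Hypothesis eta_gt0 : forall i, 0 < iota (eta i).
Hypothesis etaE : forall l, \sum_i b i * ln (absval l (eta i)) = log_direction l.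

Definition floor_unit (E : R) : Phi := \prod_i eta i ^ Num.floor (b i * ln E).

Lemma floor_unit_unit E : lattice_unit bs (floor_unit E).
Proof.
apply: (big_ind (lattice_unit bs)) => [|x y|i _]; first exact: lattice_unit1.
  exact: lattice_unitM.
exact: lattice_unitXz.
Qed.

Lemma floor_unit_gt0 E : 0 < iota (floor_unit E).
Proof.
rewrite rmorph_prod; apply: prodr_gt0 => i _.
by rewrite fmorphXz exprz_gt0.
Qed.

Lemma ln_absval_floor_unit l E : ln (absval l (floor_unit E)) =
  log_direction l * ln E - \sum_i frac_part (b i * ln E) * ln (absval l (eta i)).
Proof.
have eta0 i : eta i != 0 by have /and3P[] := etaU i.
rewrite /absval rmorph_prod cabs_prod ln_prod => [|i]; last first.
  by rewrite cabs_gt0 fmorph_eq0 expfz_neq0.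
rewrite -etaE mulr_suml -sumrB; apply: eq_bigr => i _.
rewrite -/(absval l _) absvalXz// ln_exprz ?absval_gt0//.
by rewrite mulrAC -mulrBl /frac_part opprB addrC subrK.
Qed.

Definition unit_osc : R := \sum_l \sum_i `|ln (absval l (eta i))|.

Lemma ln_absval_floor_unit_near l E :
  `|ln (absval l (floor_unit E)) - log_direction l * ln E| <= unit_osc.
Proof.
rewrite ln_absval_floor_unit addrC addKr normrN.
apply: le_trans (ler_norm_sum _ _ _) _; rewrite /unit_osc (bigD1 l)//=.
apply: ler_wpDr; first by apply: sumr_ge0 => i _; exact: sumr_ge0.
apply: ler_sum => i _; rewrite normrM ler_piMl//.
have /andP[f0 f1] := floor_itv (b i * ln E).
by rewrite /frac_part ger0_norm ?subr_ge0// lerBlDl ltW// -[1]/(1%:~R) -intrD.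
Qed.

(** A fixed unit large enough at iota for the rescaling factor to exceed 1 from E = 1 on. *)
Definition base_unit : Phi := floor_unit (expR (unit_osc *+ 2 + 1)).
Definition scaling_unit (E : R) : Phi := base_unit * floor_unit E.

Lemma scaling_unit_unit E : lattice_unit bs (scaling_unit E).
Proof. by rewrite lattice_unitM// floor_unit_unit. Qed.

Lemma scaling_unit_neq0 E : scaling_unit E != 0.
Proof. by have /and3P[] := scaling_unit_unit E. Qed.

Lemma unit_osc_ge0 : 0 <= unit_osc.
Proof. by apply: sumr_ge0 => l _; exact: sumr_ge0. Qed.

Lemma scaling_unit_gt1 E : 1 < E -> 1 < iota (scaling_unit E).
Proof.
move=> E1; have fN0 y : absval k0 (floor_unit y) \is Num.pos.
  by rewrite posrE absval_k0 normr_gt0 gt_eqF// floor_unit_gt0.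
have u0 : 0 < iota (scaling_unit E) by rewrite rmorphM mulr_gt0// floor_unit_gt0.
rewrite -ltr_ln ?posrE// ln1 -[X in ln X](gtr0_norm u0) -absval_k0 absvalM lnM; last 2 first.
- exact: fN0.
- exact: fN0.
have := ln_absval_floor_unit_near k0 E.
have := ln_absval_floor_unit_near k0 (expR (unit_osc *+ 2 + 1)).
have vk : log_direction k0 = d%:R by rewrite /log_direction eqxx.
rewrite vk expRK !ler_norml -/base_unit => /andP[h1 _] /andP[h2 _].
have h3 : 0 <= d%:R * ln E by rewrite mulr_ge0// ln_ge0// ltW.
have h4 : unit_osc *+ 2 + 1 <= d%:R * (unit_osc *+ 2 + 1).
  by rewrite ler_peMl ?ler1n// addr_ge0// mulrn_wge0// unit_osc_ge0.
by lra.
Qed.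

Definition unit_cst : R := expR (d.+1%:R * (unit_osc *+ 2 + 1) + unit_osc *+ 2).

Lemma ln_absval_scaling_unit_near l E :
  `|ln (absval l (scaling_unit E)) - log_direction l * ln E| <= ln unit_cst.
Proof.
rewrite /unit_cst expRK absvalM lnM ?posrE; last 2 first.
- by apply: absval_gt0; have /and3P[] := floor_unit_unit (expR (unit_osc *+ 2 + 1)).
- by apply: absval_gt0; have /and3P[] := floor_unit_unit E.
have := ln_absval_floor_unit_near l E.
have := ln_absval_floor_unit_near l (expR (unit_osc *+ 2 + 1)).
rewrite expRK; set t := unit_osc *+ 2 + 1.
have : `|log_direction l * t| <= d.+1%:R * t.
  have t0 : 0 <= t by rewrite addr_ge0// mulrn_wge0// unit_osc_ge0.
  rewrite normrM (ger0_norm t0) ler_wpM2r// /log_direction; case: eqVneq => _.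
    by rewrite normr_nat ler_nat.
  by rewrite normrN1 ler1n.
rewrite !ler_norml => /andP[h1 h2] /andP[h3 h4] /andP[h5 h6].
by apply/andP; split; lra.
Qed.

Lemma unit_cst_ge1 : 1 <= unit_cst.
Proof.
rewrite -expR0 ler_expR; have := unit_osc_ge0 => h.
by rewrite addr_ge0 ?mulr_ge0 ?addr_ge0// mulrn_wge0.
Qed.

Lemma iota_scaling_unit E : 0 < E ->
  unit_cst^-1 * E ^+ d <= iota (scaling_unit E) <= unit_cst * E ^+ d.
Proof.
move=> E0; have c0 := lt_le_trans ltr01 unit_cst_ge1.
have u0 : 0 < iota (scaling_unit E) by rewrite rmorphM mulr_gt0// floor_unit_gt0.
have := ln_absval_scaling_unit_near k0 E.
rewrite absval_k0 (gtr0_norm u0) /log_direction eqxx ler_norml => /andP[h1 h2].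
apply/andP; split.
  rewrite -ler_ln ?posrE ?mulr_gt0 ?exprn_gt0 ?invr_gt0//.
  by rewrite lnM ?posrE ?exprn_gt0 ?invr_gt0// lnV ?posrE// lnXn// -[_ *+ d]mulr_natl; lra.
rewrite -ler_ln ?posrE ?mulr_gt0 ?exprn_gt0//.
by rewrite lnM ?posrE ?exprn_gt0// lnXn// -[_ *+ d]mulr_natl; lra.
Qed.

Lemma absval_scaling_unit E l : 0 < E -> l != k0 ->
  unit_cst^-1 / E <= absval l (scaling_unit E) <= unit_cst / E.
Proof.
move=> E0 /negPf lk; have c0 := lt_le_trans ltr01 unit_cst_ge1.
have u0 : 0 < absval l (scaling_unit E) by rewrite absval_gt0// scaling_unit_neq0.
have := ln_absval_scaling_unit_near l E.
rewrite /log_direction lk ler_norml => /andP[h1 h2].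
apply/andP; split; rewrite -ler_ln ?posrE ?divr_gt0 ?invr_gt0//.
  by rewrite ln_div ?posrE ?invr_gt0// lnV ?posrE//; lra.
by rewrite ln_div ?posrE//; lra.
Qed.

(** * Bounded gaps *)

Let freq_sum0 : 0 < freq_sum := freq_sum_gt0.
Let unit_cst0 : 0 < unit_cst := lt_le_trans ltr01 unit_cst_ge1.

Lemma scaling_unit_gt0 E : 0 < E -> 0 < iota (scaling_unit E).
Proof.
move=> E0; have /andP[h _] := iota_scaling_unit E0; apply: lt_le_trans h.
by rewrite mulr_gt0 ?invr_gt0 ?exprn_gt0.
Qed.

(** The level iota x is represented by x itself, by injectivity of iota. *)
Definition level (x : Phi) : bool :=
  (x \in lattice bs) && [forall j, 0 <= coord bs j x].

Lemma levelP x : reflect (x \in lattice bs /\ forall j, 0 <= co x j) (level x).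
Proof.
apply: (iffP andP) => -[xL xp]; split=> //.
  by move=> j; rewrite ler0q; exact: (forallP xp).
by apply/forallP => j; rewrite -(ler0q R).
Qed.

Lemma absval_scaling_unit_inv_le E l : 1 <= E -> absval l (scaling_unit E)^-1 <= unit_cst * E.
Proof.
move=> E1; have E0 := lt_le_trans ltr01 E1; rewrite absvalV.
have u0 : 0 < absval l (scaling_unit E) by rewrite absval_gt0 ?scaling_unit_neq0.
have [->|lk] := eqVneq l k0.
  rewrite absval_k0 gtr0_norm ?scaling_unit_gt0//.
  have /andP[h _] := iota_scaling_unit E0.
  rewrite -[leLHS]mulr1 ler_pdivrMl ?scaling_unit_gt0//.
  apply: le_trans (ler_wpM2r _ h); last by rewrite mulr_ge0// ltW.
  rewrite mulrACA mulVf ?gt_eqF// mul1r.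
  have Ed : 1 <= E ^+ d by rewrite exprn_ege1.
  by rewrite -[1]mulr1; apply: ler_pM.
have /andP[h _] := absval_scaling_unit E0 lk.
rewrite -[leLHS]mulr1 ler_pdivrMl//.
apply: le_trans (ler_wpM2r _ h); last by rewrite mulr_ge0// ltW.
by rewrite mulrACA mulVf ?gt_eqF// mul1r mulVf ?gt_eqF.
Qed.

Lemma coord_mul x y j : co (x * y) j = \sum_i co x i * co (bs`_i * y) j.
Proof.
rewrite {1}(coord_sum bsP x) mulr_suml linear_sum /= rmorph_sum.
by apply: eq_bigr => i _; rewrite -scalerAl linearZ /= rmorphM.
Qed.

(** [C1 * F] bounds the coordinates of the products of the basis elements by the
    inverse of the unit of scale [F]; [K1 * F] bounds the effect of rounding by at
    most 2 in each coordinate; [E / K2] is the scale at which the negative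
    coordinate of the step is at most a coordinate of the given level. *)
Let nR : R := d.+1%:R.
Let C1 : R := coord_cst * (embed_cst * unit_cst).
Let K1 : R := 2 * nR * C1.
Let K2 : R := 2 * K1 * nR * freq_sum + 1.
Definition gap_cst : R := unit_cst ^+ 2 * K2 ^+ d * (2 * freq_sum).

(** Some coordinate j0 of x is at least a constant times E, so a step from x may have a
    negative coordinate at j0 provided that the others are nonnegative.  A real vector of this
    shape is chosen in the kernel of iota, with coordinates of size F, a constant times E;
    multiplied by the unit u of scale F, rounded up in the lattice, and divided by u again, it
    moves by O(F) and its value under iota becomes positive and O(1 / F^d). *)
Lemma next_level_close E x : 1 < E -> level x -> E <= iota x ->
  exists y, [/\ level y, iota x < iota y &
    iota (scaling_unit E) * (iota y - iota x) <= gap_cst].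
Proof.
move=> E1 /levelP[xL xp] Ex; have E0 := lt_trans ltr01 E1.
have C10 : 0 <= C1.
  by rewrite /C1 !mulr_ge0 ?coord_cst_ge0 ?embed_cst_ge0 ?(ltW unit_cst0).
have n1 : 1 <= nR by rewrite ler1n.
have n0 := lt_le_trans ltr01 n1.
have K10 : 0 <= K1 := mulr_ge0 (mulr_ge0 (ler0n _ _) (ltW n0)) C10.
have K21 : 1 <= K2.
  rewrite /K2 lerDr.
  exact: (mulr_ge0 (mulr_ge0 (mulr_ge0 (ler0n _ _) K10) (ltW n0)) (ltW freq_sum0)).
have K20 := lt_le_trans ltr01 K21.
have [EK|EK] := ltP E K2.
  pose i0 : 'I_d.+1 := ord0.
  (* For E bounded, a step by the first basis element is short enough. *)
  exists (x + bs`_i0); split.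
  - apply/levelP; split=> [|j]; last first.
      rewrite linearD rmorphD /= (coord_nth bsP j i0) ratr_nat.
      by rewrite addr_ge0.
    rewrite rpredD//; apply/latticeP => j.
    by rewrite (coord_nth bsP j i0) rpred_nat.
  - by rewrite rmorphD ltrDl.
  - rewrite rmorphD addrC addKr /gap_cst.
    have /andP[_ h] := iota_scaling_unit E0.
    apply: ler_pM; [by rewrite ltW// scaling_unit_gt0|by rewrite ltW| |].
      apply: le_trans h _; rewrite expr2 -mulrA.
      apply: ler_wpM2l; first exact: ltW.
      apply: (@le_trans _ _ (K2 ^+ d)); first by rewrite lerXn2r ?nnegrE// ltW.
      by rewrite ler_peMl ?exprn_ge0 ?unit_cst_ge1 ?(ltW K20).
    rewrite mulr_natl mulr2n; apply: ler_wpDr; first exact: ltW.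
    rewrite /freq_sum (bigD1 ord0)//= lerDl sumr_ge0// => i _; exact: ltW.
pose F := E / K2.
have F1 : 1 <= F by rewrite ler_pdivlMr// mul1r.
have F0 := lt_le_trans ltr01 F1.
have [j0 xj0] : exists j0, E / nR <= co x j0 * om j0.
  apply/not_existsP => H; have : iota x < E; last by rewrite ltNge Ex.
  rewrite iota_coord.
  have -> : E = \sum_(j < d.+1) (E / nR).
    by rewrite sumr_const card_ord -[_ *+ _]mulr_natr divfK ?gt_eqF.
  apply: ltr_sum => [|j _]; first by apply/hasP; exists ord0; rewrite ?mem_index_enum.
  by rewrite ltNge; apply/negP/H.
(* v lies in the kernel of iota and has its only negative coordinate at j0. *)
pose v m : R := if m == j0 then - ((freq_sum - om j0) / om j0) else 1.
have vom : \sum_(m < d.+1) v m * om m = 0.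
  rewrite (bigD1 j0)//= {1}/v eqxx mulNr divfK ?gt_eqF// opprB /freq_sum.
  rewrite (bigD1 j0)//= opprD addNKr addrC; apply/eqP; rewrite subr_eq0; apply/eqP.
  by apply: eq_bigr => m /negPf mj; rewrite /v mj mul1r.
set u := scaling_unit F; pose U := u^-1.
have u0 : u != 0 by exact: scaling_unit_neq0.
pose p i : R := \sum_m (K1 * F * v m) * co (bs`_m * u) i.
(* Rounding to floor + 2 makes every coordinate grow by more than 1, which ensures that
   iota X is positive. *)
pose X := \sum_i ((Num.floor (p i) + 2)%:~R : rat) *: bs`_i.
have cX i : coord bs i X = (Num.floor (p i) + 2)%:~R.
  rewrite /X linear_sum (bigD1 i)//= linearZ /= (coord_nth bsP) eqxx mulr1.
  rewrite big1 ?addr0// => j ji; rewrite linearZ /= (coord_nth bsP).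
  by rewrite eq_sym (negPf ji) mulr0.
have coX i : co X i = (Num.floor (p i) + 2)%:~R by rewrite cX ratr_int.
have errP i : 0 < co X i - p i <= 2.
  rewrite coX intrD; have /andP[f0 f1] := floor_itv (p i).
  by move: f1; rewrite intrD => f1; apply/andP; split; lra.
have XL : X \in lattice bs by apply/latticeP => j; rewrite cX intr_int.
have pom : \sum_(i < d.+1) p i * om i = 0.
  rewrite /p (eq_bigr (fun i : 'I_d.+1 => \sum_m K1 * F * v m * (co (bs`_m * u) i * om i))); last first.
    by move=> i _; rewrite mulr_suml; apply: eq_bigr => m _; rewrite mulrA.
  rewrite exchange_big /= (eq_bigr (fun m : 'I_d.+1 => K1 * F * iota u * (v m * om m))).
    by rewrite -mulr_sumr vom mulr0.
  move=> m _; rewrite -mulr_sumr -iota_coord rmorphM.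
  by rewrite [om m * _]mulrC mulrACA.
have iX : 0 < iota X <= 2 * freq_sum.
  have -> : iota X = \sum_(i < d.+1) (co X i - p i) * om i.
    rewrite (iota_coord X) -[LHS]subr0 -[X in _ - X]pom -sumrB.
    by apply: eq_bigr => i _; rewrite mulrBl.
  apply/andP; split.
    rewrite big_ord_recl ltr_pwDl//; first by have /andP[e0 _] := errP ord0; rewrite mulr_gt0.
    by rewrite sumr_ge0// => i _; have /andP[e0 _] := errP (lift ord0 i); rewrite mulr_ge0// ltW.
  rewrite /freq_sum mulr_sumr; apply: ler_sum => i _.
  by have /andP[_ e2] := errP i; rewrite ler_wpM2r// ltW.
pose dl := X * U.
have pU j : \sum_i p i * co (bs`_i * U) j = K1 * F * v j.
  rewrite /p (eq_bigr (fun i : 'I_d.+1 => \sum_m K1 * F * v m * (co (bs`_m * u) i * co (bs`_i * U) j))); last first.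
    by move=> i _; rewrite mulr_suml; apply: eq_bigr => m _; rewrite mulrA.
  rewrite exchange_big /= (bigD1 j)//= [X in _ + X]big1 ?addr0 => [|m mj].
    by rewrite -mulr_sumr -coord_mul mulfK// (coord_nth bsP) eqxx ratr_nat mulr1.
  by rewrite -mulr_sumr -coord_mul mulfK// (coord_nth bsP) eq_sym (negPf mj) ratr_nat mulr0.
have coU (i j : 'I_d.+1) : `|co (bs`_i * U) j| <= C1 * F.
  rewrite /C1 -mulrA; apply: coord_le => // l; rewrite absvalM -mulrA.
  apply: ler_pM; [exact: cabs_ge0|exact: cabs_ge0| |exact: absval_scaling_unit_inv_le].
  rewrite /embed_cst (bigD1 l)//= (bigD1 i)//= -addrA lerDl addr_ge0//.
    by rewrite sumr_ge0// => *; exact: cabs_ge0.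
  by rewrite sumr_ge0// => *; rewrite sumr_ge0// => *; exact: cabs_ge0.
have codl j : `|co dl j - K1 * F * v j| <= K1 * F.
  rewrite /dl coord_mul -pU -sumrB (eq_bigr (fun i => (co X i - p i) * co (bs`_i * U) j)); last first.
    by move=> i _; rewrite mulrBl.
  apply: le_trans (ler_norm_sum _ _ _) _.
  have -> : K1 * F = \sum_(i < d.+1) 2 * (C1 * F).
    rewrite sumr_const card_ord -[_ *+ _]mulr_natr /K1 -/nR; ring.
  apply: ler_sum => i _; have /andP[e0 e2] := errP i.
  by rewrite normrM ler_pM// ger0_norm// ltW.
have U0 : 0 < iota U by rewrite fmorphV invr_gt0 scaling_unit_gt0.
exists (x + dl); split.
- apply/levelP; split=> [|j].
    rewrite rpredD//; apply: latticeM => //.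
    by have /and3P[] := scaling_unit_unit F.
  rewrite linearD rmorphD /=; have := codl j; rewrite ler_norml /v.
  case: eqVneq => [->|jj0] /andP[h _]; last first.
    by have := xp j; rewrite mulr1 in h; lra.
  have om0 := bs_gt0 j0.
  rewrite -(pmulr_lge0 _ om0) mulrDl.
  have h' : - (K1 * F) * om j0 <= (co dl j0 + K1 * F * ((freq_sum - om j0) / om j0)) * om j0.
    by apply: ler_wpM2r; [exact: ltW | move: h; rewrite mulrN opprK].
  rewrite mulrDl -[_ * (_ / _) * _]mulrA divfK ?gt_eqF// in h'.
  suff: K1 * F * freq_sum <= E / nR.
    move: h' xj0; rewrite mulrBr mulNr; move: (co dl j0 * _) (co x j0 * _) (K1 * F * om j0) (K1 * F * freq_sum) (E / nR).
    by move=> a1 a2 a3 a4 a5; lra.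
  have EF : E = F * K2 by rewrite /F divfK ?gt_eqF.
  rewrite ler_pdivlMr// EF.
  have -> : K1 * F * freq_sum * nR = F * (K1 * nR * freq_sum) by ring.
  rewrite ler_pM2l// /K2.
  have t0 : 0 <= K1 * nR * freq_sum := mulr_ge0 (mulr_ge0 K10 (ltW n0)) (ltW freq_sum0).
  have -> : 2 * K1 * nR * freq_sum = 2 * (K1 * nR * freq_sum) by rewrite !mulrA.
  by move: (K1 * nR * freq_sum) t0 => t t0; lra.
- by rewrite rmorphD ltrDl rmorphM mulr_gt0//; have /andP[] := iX.
- rewrite rmorphD addrC addKr /gap_cst.
  rewrite [iota dl](_ : _ = iota X * iota U); last exact: rmorphM.
  rewrite mulrA; have /andP[iX0 iX2] := iX; rewrite mulrAC; apply: ler_pM => //.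
  + by apply: mulr_ge0; apply: ltW => //; exact: scaling_unit_gt0.
  + exact: ltW.
  have /andP[_ h1] := iota_scaling_unit E0.
  have /andP[h2 _] := iota_scaling_unit F0.
  rewrite fmorphV ler_pdivrMr ?scaling_unit_gt0//; apply: le_trans h1 _.
  have h3 : unit_cst ^+ 2 * K2 ^+ d * (unit_cst^-1 * F ^+ d) <=
            unit_cst ^+ 2 * K2 ^+ d * iota (scaling_unit F).
    by apply: ler_wpM2l => //; rewrite mulr_ge0 ?exprn_ge0 ?(ltW unit_cst0) ?(ltW K20).
  apply: le_trans h3; rewrite /F exprMn exprVn.
  rewrite le_eqVlt; apply/orP; left; apply/eqP.
  have c1 : unit_cst != 0 by rewrite gt_eqF.
  have c2 : K2 ^+ d != 0 by rewrite gt_eqF// exprn_gt0.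
  by field; rewrite c1 c2.
Qed.

Definition freq_inv_sum : R := \sum_(j < d.+1) (om j)^-1.
Definition spacing_cst : R :=
  coord_cst * (gap_cst + unit_cst * (embed_cst * (2 * freq_inv_sum))).

(** At iota the bound is the one on gaps; at the other embeddings the difference of two levels
    is O(E) and the unit is O(1/E). *)
Lemma spacing_bounded E x y : 1 < E -> level x -> level y ->
  E <= iota x -> iota x < iota y -> iota y < E + 1 ->
  (forall z, level z -> iota x < iota z -> iota y <= iota z) ->
  scaling_unit E * (y - x) \in lattice bs /\
  forall j, `|co (scaling_unit E * (y - x)) j| <= spacing_cst.
Proof.
move=> E1 xl yl Ex xy yE nxt; have E0 := lt_trans ltr01 E1.
have /levelP[xL xp] := xl; have /levelP[yL yp] := yl.
split.
  rewrite mulrC; apply: latticeM => //; first exact: rpredB.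
  by have /and3P[] := scaling_unit_unit E.
have inv0 : 0 <= freq_inv_sum by rewrite sumr_ge0// => j _; rewrite invr_ge0 ltW.
have co_le z : level z -> iota z < E + 1 -> forall j, 0 <= co z j <= 2 * E * freq_inv_sum.
  move=> /levelP[zL zp] zE j; rewrite zp /=.
  apply: (@le_trans _ _ (2 * E / om j)).
    rewrite ler_pdivlMr//; apply: (@le_trans _ _ (iota z)); last by lra.
    rewrite (iota_coord z) (bigD1 j)//= lerDl sumr_ge0// => i _.
    by rewrite mulr_ge0// ltW.
  rewrite ler_wpM2l ?mulr_ge0 ?(ltW E0)// /freq_inv_sum (bigD1 j)//= lerDl sumr_ge0// => i _.
  by rewrite invr_ge0 ltW.
have c0 : 0 <= unit_cst * (embed_cst * (2 * freq_inv_sum)).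
  by rewrite !mulr_ge0 ?embed_cst_ge0 ?(ltW unit_cst0).
have [z [zl xz gz]] := next_level_close E1 xl Ex.
have g0 : 0 <= gap_cst.
  by apply: le_trans gz; rewrite mulr_ge0 ?subr_ge0// ltW// scaling_unit_gt0.
move=> j; rewrite /spacing_cst; apply: coord_le => l.
have [->|lk] := eqVneq l k0.
  rewrite absval_k0 ger0_norm; last first.
    by rewrite rmorphM mulr_ge0 ?(ltW (scaling_unit_gt0 E0))// rmorphB subr_ge0 ltW.
  rewrite rmorphM rmorphB; apply: (@le_trans _ _ gap_cst); last by rewrite lerDl.
  by apply: le_trans gz; rewrite ler_pM2l ?scaling_unit_gt0// lerD2r nxt.
apply: (@le_trans _ _ (unit_cst * (embed_cst * (2 * freq_inv_sum)))); last by rewrite lerDr.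
have /andP[_ h] := absval_scaling_unit E0 lk; rewrite absvalM.
have -> : unit_cst * (embed_cst * (2 * freq_inv_sum)) = (unit_cst / E) * (embed_cst * (2 * E * freq_inv_sum)).
  by field; rewrite gt_eqF.
apply: ler_pM => //; try exact: cabs_ge0.
apply: absval_le => i; rewrite linearB rmorphB /=.
have xE : iota x < E + 1 := lt_trans xy yE.
have /andP[] := co_le x xl xE i; have /andP[] := co_le y yl yE i.
by rewrite ler_norml => *; apply/andP; split; lra.
Qed.

(** * Dependence of the rescaling unit on the scale *)

Context (phi : 'I_d.+1 -> 'I_r -> R).
Hypothesis phiP : forall l i, polar (sg l (eta i)) (phi l i).

Definition angle l : R := - (\sum_i b i * phi l i) / (2 * pi).
Definition orbit_phase l E : R[i] := cis (2 * pi * (ln E * angle l)).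
Definition orbit_frac i E : R := frac_part (b i * ln E).
(** The factor coming from the fractional parts when each floor is written as its argument
    minus a fractional part.  The arguments themselves contribute a modulus E, which the
    division by E cancels, and the phase orbit_phase. *)
Definition fiber l E : R[i] :=
  (expR (\sum_i orbit_frac i E * ln (absval l (eta i))))%:C%C *
  cis (\sum_i orbit_frac i E * phi l i).

Lemma inv_scaling_unit_orbit l E : 0 < E -> l != k0 ->
  sg l (scaling_unit E)^-1 * (E^-1)%:C%C =
  sg l base_unit^-1 * (orbit_phase l E * fiber l E).
Proof.
move=> E0 lk; have fl0 : 0 < absval l (floor_unit E).
  by apply: absval_gt0; have /and3P[] := floor_unit_unit E.
rewrite /scaling_unit invfM rmorphM -!mulrA; congr (_ * _).
have fp : polar (sg l (floor_unit E)) (\sum_i (Num.floor (b i * ln E))%:~R * phi l i).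
  rewrite rmorph_prod; apply: polar_prod => i; rewrite fmorphXz.
  exact: polarXz.
rewrite fmorphV (polarV fp) cabsV -/(absval l _) mulrAC -rmorphM.
rewrite /fiber [RHS]mulrCA -cisD; congr (_%:C%C * cis _).
  rewrite -[LHS]lnK ?posrE ?mulr_gt0 ?invr_gt0//; congr expR.
  rewrite lnM ?posrE ?invr_gt0// !lnV ?posrE// ln_absval_floor_unit /log_direction (negPf lk).
  by rewrite /orbit_frac; lra.
have -> : 2 * pi * (ln E * angle l) = - (ln E * \sum_i b i * phi l i).
  rewrite /angle; have := lt0r_neq0 (pi_gt0 R); move: (pi : R) => p p0.
  by field.
rewrite mulr_sumr -!sumrN -big_split /=.
by apply: eq_bigr => i _; rewrite /orbit_frac /frac_part; ring.
Qed.

Lemma orbit_frac_itv i E : 0 <= orbit_frac i E <= 1.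
Proof.
have /andP[f0 f1] := floor_itv (b i * ln E).
by move: f1; rewrite intrD /orbit_frac /frac_part => f1; apply/andP; split; lra.
Qed.

Lemma unit_osc_le l E : \sum_i orbit_frac i E * ln (absval l (eta i)) <= unit_osc.
Proof.
rewrite /unit_osc (bigD1 l)//=; apply: ler_wpDr.
  by apply: sumr_ge0 => *; exact: sumr_ge0.
apply: ler_sum => i _; have /andP[f0 f1] := orbit_frac_itv i E.
apply: le_trans (ler_wpM2l f0 (ler_norm _)) _.
by rewrite ler_piMl.
Qed.

Definition fiber_cst : R :=
  expR unit_osc * (unit_osc + 2 * \sum_l \sum_i `|phi l i|).

Lemma frac_sum_lip (y : 'I_d.+1 -> 'I_r -> R) l E E' :
  `|\sum_i orbit_frac i E * y l i - \sum_i orbit_frac i E' * y l i| <=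
  (\sum_l \sum_i `|y l i|) * \sum_i `|orbit_frac i E - orbit_frac i E'|.
Proof.
rewrite -sumrB mulr_sumr; apply: le_trans (ler_norm_sum _ _ _) _.
apply: ler_sum => i _; rewrite -mulrBl normrM mulrC ler_wpM2r//.
rewrite (bigD1 l)//= (bigD1 i)//= -addrA lerDl addr_ge0//; first exact: sumr_ge0.
by apply: sumr_ge0 => *; exact: sumr_ge0.
Qed.

Lemma fiber_lip l E E' : cabs (fiber l E - fiber l E') <=
  fiber_cst * \sum_i `|orbit_frac i E - orbit_frac i E'|.
Proof.
rewrite /fiber; set x := \sum_i _; set x' := \sum_i _ * ln _.
set y := \sum_i _; set y' := \sum_i _ * phi _ _.
have xx' : `|x - x'| <= unit_osc * \sum_i `|orbit_frac i E - orbit_frac i E'|.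
  exact: (frac_sum_lip (fun l i => ln (absval l (eta i)))).
have yy' := frac_sum_lip phi l E E'; rewrite -/y -/y' in yy'.
have -> : (expR x)%:C%C * cis y - (expR x')%:C%C * cis y' =
   (expR x - expR x')%:C%C * cis y + (expR x')%:C%C * (cis y - cis y').
  by rewrite rmorphB /= mulrBl mulrBr addrA subrK.
apply: le_trans (cabsD _ _) _; rewrite !cabsM cabs_cis mulr1 !cabs_real.
rewrite [`|expR x'|]ger0_norm ?expR_ge0// /fiber_cst -mulrA mulrDl mulrDr.
apply: lerD.
  apply: le_trans (expR_lip (unit_osc_le l E) (unit_osc_le l E')) _.
  by rewrite ler_wpM2l ?expR_ge0.
apply: ler_pM; rewrite ?expR_ge0 ?cabs_ge0// ?ler_expR ?unit_osc_le//.
by apply: le_trans (cis_lip _ _) _; rewrite -mulrA ler_wpM2l.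
Qed.

Definition orbit_dist E E' : R :=
  \sum_l cabs (orbit_phase l E - orbit_phase l E') +
  \sum_i `|orbit_frac i E - orbit_frac i E'|.

Definition orbit_cst : R :=
  1 + \sum_l absval l base_unit^-1 * (expR unit_osc + fiber_cst).

(** At iota both terms are already O(1/E); elsewhere the previous factorization is Lipschitz in
    each of its factors, which are bounded. *)
Lemma inv_scaling_unit_lip l E E' : 1 < E -> 1 < E' ->
  cabs (sg l (scaling_unit E)^-1 * (E^-1)%:C%C -
        sg l (scaling_unit E')^-1 * (E'^-1)%:C%C) <=
  orbit_cst * (orbit_dist E E' + (E^-1 + E'^-1)).
Proof.
move=> E1 E'1; have E0 := lt_trans ltr01 E1; have E'0 := lt_trans ltr01 E'1.
have phi0 : 0 <= \sum_l \sum_i `|phi l i| by apply: sumr_ge0 => *; exact: sumr_ge0.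
have fc0 : 0 <= fiber_cst.
  by rewrite mulr_ge0 ?expR_ge0// addr_ge0 ?unit_osc_ge0// mulr_ge0.
have t0 m : 0 <= absval m base_unit^-1 * (expR unit_osc + fiber_cst).
  by rewrite mulr_ge0 ?cabs_ge0// addr_ge0 ?expR_ge0.
have s0 : 0 <= \sum_l absval l base_unit^-1 * (expR unit_osc + fiber_cst) by exact: sumr_ge0.
have p0 : 0 <= \sum_l cabs (orbit_phase l E - orbit_phase l E').
  by apply: sumr_ge0 => *; exact: cabs_ge0.
have q0 : 0 <= \sum_i `|orbit_frac i E - orbit_frac i E'| by exact: sumr_ge0.
have o0 : 0 <= orbit_dist E E' by rewrite addr_ge0.
have i0 : 0 <= E^-1 + E'^-1 by rewrite addr_ge0// invr_ge0 ltW.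
have [->|lk] := eqVneq l k0.
  have kle F : 1 < F -> cabs (sg k0 (scaling_unit F)^-1 * (F^-1)%:C%C) <= F^-1.
    move=> F1; have F0 := lt_trans ltr01 F1.
    rewrite cabsM cabs_real [X in _ * X]gtr0_norm ?invr_gt0// -[leRHS]mul1r.
    rewrite ler_wpM2r ?invr_ge0 ?(ltW F0)// -/(absval k0 _) absval_k0 fmorphV normfV.
    by rewrite invf_le1 ?normr_gt0 ?gtr0_norm ?ltW ?scaling_unit_gt1 ?gt_eqF ?scaling_unit_gt0.
  apply: le_trans (cabsD _ _) _; rewrite cabsN.
  apply: le_trans (lerD (kle _ E1) (kle _ E'1)) _.
  rewrite /orbit_cst mulrDl mul1r; apply: ler_wpDr; first by rewrite mulr_ge0// addr_ge0.
  by rewrite lerDr.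
rewrite !inv_scaling_unit_orbit// -mulrBr cabsM.
apply: (@le_trans _ _ (absval l base_unit^-1 * (expR unit_osc + fiber_cst) * orbit_dist E E')); last first.
  apply: ler_pM => //; last by rewrite lerDl.
  rewrite /orbit_cst; apply: ler_wpDl => //.
  by rewrite [leRHS](bigD1 l)//= lerDl sumr_ge0.
rewrite -mulrA ler_wpM2l ?cabs_ge0//.
have -> : orbit_phase l E * fiber l E - orbit_phase l E' * fiber l E' =
  (orbit_phase l E - orbit_phase l E') * fiber l E +
  orbit_phase l E' * (fiber l E - fiber l E').
  by rewrite mulrBl mulrBr addrA subrK.
apply: le_trans (cabsD _ _) _; rewrite (cabsM _ (fiber l E)) (cabsM (orbit_phase l E')).
rewrite [cabs (orbit_phase l E')]cabs_cis mul1r mulrDl.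
apply: lerD.
  rewrite [leLHS]mulrC; apply: ler_pM; [exact: cabs_ge0|exact: cabs_ge0| |].
    by rewrite /fiber cabsM cabs_cis mulr1 cabs_real ger0_norm ?expR_ge0// ler_expR unit_osc_le.
  rewrite /orbit_dist; apply: ler_wpDr => //.
  by rewrite (bigD1 l)//= lerDl sumr_ge0// => *; exact: cabs_ge0.
apply: le_trans (fiber_lip _ _ _) _; rewrite ler_wpM2l// lerDr.
exact: p0.
Qed.

Lemma co_scaling_unit_lip p j : exists2 C, 0 <= C & forall E E', 1 < E -> 1 < E' ->
  `|co (p / scaling_unit E) j / E - co (p / scaling_unit E') j / E'| <=
  C * (orbit_dist E E' + (E^-1 + E'^-1)).
Proof.
exists (\sum_l cabs (A l j * sg l p) * orbit_cst).
  apply: sumr_ge0 => l _; rewrite mulr_ge0 ?cabs_ge0// addr_ge0//.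
  apply: sumr_ge0 => m _; rewrite mulr_ge0 ?cabs_ge0// addr_ge0 ?expR_ge0//.
  rewrite mulr_ge0 ?expR_ge0// addr_ge0 ?unit_osc_ge0// mulr_ge0//.
  by apply: sumr_ge0 => *; exact: sumr_ge0.
move=> E E' E1 E'1.
have coE F : (co (p / scaling_unit F) j / F)%:C%C =
    \sum_l (A l j * sg l p) * (sg l (scaling_unit F)^-1 * (F^-1)%:C%C) :> R[i].
  rewrite rmorphM /= -ratr_complex sg_coord mulr_suml.
  by apply: eq_bigr => l _; rewrite rmorphM /= !mulrA.
rewrite -cabs_real rmorphB [X in X - _]coE [X in _ - X]coE -sumrB.
apply: le_trans (cabs_sum _ _ _) _; rewrite mulr_suml; apply: ler_sum => l _.
rewrite -mulrBr [leLHS]cabsM -[leRHS]mulrA; apply: ler_wpM2l; first exact: cabs_ge0.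
exact: inv_scaling_unit_lip.
Qed.

End ScalingUnit.

Lemma bounded_lattice_seq (B : R) : exists S : seq Phi,
  [/\ uniq S, 0 \in S, {subset S <= lattice bs} &
      forall x, x \in lattice bs -> (forall j, `|co x j| <= B) -> x \in S].
Proof.
pose N := Num.truncn B; pose T := {ffun 'I_d.+1 -> 'I_(N + N).+1}.
pose pt (m : T) : Phi := \sum_j ((m j)%:R - N%:R : rat) *: bs`_j.
have cpt (m : T) j : coord bs j (pt m) = (m j)%:R - N%:R.
  rewrite /pt linear_sum (bigD1 j)//= linearZ /= (coord_nth bsP) eqxx mulr1.
  rewrite big1 ?addr0// => i ij; rewrite linearZ /= (coord_nth bsP).
  by rewrite eq_sym (negPf ij) mulr0.
exists (undup (0 :: [seq pt m | m <- enum {: T}])); split.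
- exact: undup_uniq.
- by rewrite mem_undup mem_head.
- move=> x; rewrite mem_undup inE => /orP[/eqP ->|/mapP[m _ ->]]; first exact: rpred0.
  by apply/latticeP => j; rewrite cpt rpredB// rpred_nat.
move=> x /latticeP xL xB; rewrite mem_undup inE; apply/orP; right.
have mP j : exists k : 'I_(N + N).+1, coord bs j x == k%:R - N%:R.
  have /intrP[z zE] := xL j; have := xB j; rewrite zE ratr_int -intr_norm -natr_absz.
  move=> zB; have zN : (absz z <= N)%N.
    by rewrite /N truncn_ge_nat// (le_trans _ zB).
  have k_lt : (absz (z + N%:Z)%R < (N + N).+1)%N by lia.
  exists (Ordinal k_lt); apply/eqP; rewrite /= natr_absz ger0_norm; last by lia.
  by rewrite intrD /= -pmulrn addrK.
apply/mapP; exists [ffun j => xchoose (mP j)]; first by rewrite mem_enum.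
rewrite [LHS](coord_sum bsP); apply: eq_bigr => j _; congr (_ *: _).
by rewrite ffunE; exact: (eqP (xchooseP (mP j))).
Qed.

End Scaling.

(** * Counting levels by their shifts *)

Section Levels.
Context (R : realType) (d : nat) (Phi : fieldExtType rat).
Context (iota : {rmorphism Phi -> R}) (bs : d.+1.-tuple Phi).
Hypothesis bsP : basis_of {:Phi}%VS bs.
Hypothesis bs_gt0 : forall i : 'I_d.+1, 0 < iota bs`_i.
Hypothesis bs0 : bs`_0 = 1.
Context (omega : 'I_d -> R).
Hypothesis omegaE : forall i : 'I_d, omega i = iota bs`_i.+1.

Local Notation co x j := (ratr (coord bs j x) : R).
Local Notation om j := (iota bs`_j).
Local Notation level := (level bs).

Lemma omega_gt0 i : 0 < omega i.
Proof. by rewrite omegaE; exact: (bs_gt0 (lift ord0 i)). Qed.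

Lemma level_coord_nat x : level x ->
  exists m : 'I_d.+1 -> nat, forall j, coord bs j x = (m j)%:R.
Proof.
case/(levelP R) => /latticeP xL xp; exists (fun j => absz (numq (coord bs j x))) => j.
have /intrP[k kE] := xL j; have := xp j; rewrite kE numq_int ratr_int ler0z => k0.
by rewrite natr_absz ger0_norm.
Qed.

Lemma energy_levelP e : energy_levels omega e <-> exists2 x, level x & e = iota x.
Proof.
split=> [[m0 [m ->]]|[x xl ->]]; last first.
  have [m mE] := level_coord_nat xl; exists (m ord0), (fun i => m (lift ord0 i)).
  rewrite (iota_coord iota bsP) big_ord_recl mE ratr_nat bs0 rmorph1 mulr1.
  by congr (_ + _); apply: eq_bigr => i _; rewrite mE ratr_nat omegaE.
pose M (j : 'I_d.+1) := if unlift ord0 j is Some i then m i else m0.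
pose x := \sum_(j < d.+1) (M j)%:R *: bs`_j.
have cx j : coord bs j x = (M j)%:R.
  rewrite /x linear_sum (bigD1 j)//= linearZ /= (coord_nth bsP) eqxx mulr1.
  rewrite big1 ?addr0// => i ij; rewrite linearZ /= (coord_nth bsP).
  by rewrite eq_sym (negPf ij) mulr0.
exists x.
  apply/(levelP R); split=> [|j]; last by rewrite cx ratr_nat.
  by apply/latticeP => j; rewrite cx rpred_nat.
rewrite (iota_coord iota bsP) big_ord_recl cx ratr_nat bs0 rmorph1 mulr1 /M unlift_none.
by congr (_ + _); apply: eq_bigr => i _; rewrite cx /M liftK ratr_nat omegaE.
Qed.

Local Notation window := (window_levels omega).

Lemma mem_window E e : e \in window E <-> energy_levels omega e /\ E <= e < E + 1.
Proof. by have [_] := window_levelsP E omega_gt0; apply. Qed.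

Lemma window_uniq E : uniq (window E).
Proof. by have [/lt_sorted_uniq] := window_levelsP E omega_gt0. Qed.

Definition ratios : seq R := [seq iota b | b <- behead bs].

Lemma size_ratios : size ratios = d.
Proof. by rewrite size_map size_behead size_tuple. Qed.

Lemma nth_ratios i : (i < d)%N -> ratios`_i = om i.+1.
Proof. by move=> id; rewrite (nth_map 0) ?nth_behead// size_behead size_tuple. Qed.

Lemma ratios_gt0 : all (> 0) ratios.
Proof.
apply/(all_nthP 0) => i; rewrite size_ratios => id.
by rewrite nth_ratios//; exact: (bs_gt0 (lift ord0 (Ordinal id))).
Qed.

Lemma dot_ratios t : size t = d -> dot t ratios = \sum_(i < d) (nth 0%N t i)%:R * om i.+1.
Proof.
have dotE (ws : seq R) s : size s = size ws ->
    dot s ws = \sum_(i < size ws) (nth 0%N s i)%:R * ws`_i.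
  elim: s ws => [|m s IHs] [|w ws]//=; first by rewrite big_ord0.
  by case=> /IHs ->; rewrite big_ord_recl.
move=> td; rewrite dotE size_ratios//; apply: eq_bigr => i _.
by rewrite nth_ratios.
Qed.

Definition above (a : 'I_d.+1 -> nat) (e : R) : Prop :=
  exists x, [/\ level x, e = iota x & forall j, (a j)%:R <= co x j].

(** After translation by a, the coordinates of index at least 1 can be any point of a simplex,
    and the coordinate of index 0, along the basis element 1, is then determined by the window
    of length 1: it is the ceiling m0, which is nonnegative exactly when the point lies in
    the simplex. *)
Lemma count_above (a : 'I_d.+1 -> nat) E :
  count (fun e => `[< above a e >]) (window E) =
  size (simplex_points ratios (E + 1 - \sum_(j < d.+1) (a j)%:R * om j)).
Proof.
set L := \sum_(j < d.+1) _; set X := E + 1 - L.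
pose m0 t : nat := `|Num.ceil (E - L - dot t ratios)|%N.
pose pt (t : seq nat) (m : nat) : Phi :=
  \sum_(j < d.+1) (a j + nth 0%N (m :: t) j)%:R *: bs`_j.
have cpt t m j : coord bs j (pt t m) = (a j + nth 0%N (m :: t) j)%:R.
  rewrite /pt linear_sum (bigD1 j)//= linearZ /= (coord_nth bsP) eqxx mulr1.
  rewrite big1 ?addr0// => i ij; rewrite linearZ /= (coord_nth bsP).
  by rewrite eq_sym (negPf ij) mulr0.
have ipt t m : size t = d -> iota (pt t m) = L + m%:R + dot t ratios.
  move=> td; rewrite (iota_coord iota bsP).
  rewrite (eq_bigr (fun j : 'I_d.+1 => (a j)%:R * om j + (nth 0%N (m :: t) j)%:R * om j)).
    rewrite big_split /= -/L -addrA; congr (_ + _).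
    by rewrite big_ord_recl /= bs0 rmorph1 mulr1 dot_ratios.
  by move=> j _; rewrite cpt ratr_nat natrD mulrDl.
have m0E t : dot t ratios < X -> (m0 t)%:R = (Num.ceil (E - L - dot t ratios))%:~R :> R.
  move=> tX; rewrite /m0 natr_absz ger0_norm// -ltzD1 -(ltr_int R) intrD.
  have /andP[_ h] := ceil_itv (E - L - dot t ratios).
  by move: tX; rewrite /X => tX; lra.
have ptw t : t \in simplex_points ratios X -> E <= iota (pt t (m0 t)) < E + 1.
  rewrite mem_simplex_points ?ratios_gt0// size_ratios => /andP[/eqP td tX].
  rewrite ipt// m0E//; have /andP[h1 h2] := ceil_itv (E - L - dot t ratios).
  by move: h1; rewrite intrB => h1; apply/andP; split; lra.
have ptl t m : level (pt t m).
  apply/(levelP R); split=> [|j]; last by rewrite cpt ratr_nat.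
  by apply/latticeP => j; rewrite cpt rpred_nat.
rewrite -size_filter; pose f t := iota (pt t (m0 t)).
rewrite -[RHS](size_map f); apply: perm_size; apply: uniq_perm.
- by rewrite filter_uniq// window_uniq.
- rewrite map_inj_in_uniq ?simplex_points_uniq// => t t'.
  rewrite !mem_simplex_points ?ratios_gt0// size_ratios => /andP[/eqP td _] /andP[/eqP td' _].
  move=> /fmorph_inj ptE; apply: (@eq_from_nth _ 0%N); first by rewrite td td'.
  move=> i; rewrite td => id; have := congr1 (coord bs (lift ord0 (Ordinal id))) ptE.
  by rewrite !cpt /= => /eqP; rewrite eqr_nat eqn_add2l => /eqP.
move=> e; rewrite mem_filter; apply/andP/mapP.
  case=> /asboolP[x [xl -> ax]] /mem_window[_ /andP[Ee eE]].
  have [m mE] := level_coord_nat xl.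
  have am j : (a j <= m j)%N by have := ax j; rewrite mE ratr_nat ler_nat.
  pose t := mkseq (fun i => m (inord i.+1) - a (inord i.+1))%N d.
  have td : size t = d by rewrite size_mkseq.
  have tn (i : 'I_d) : nth 0%N t i = (m (lift ord0 i) - a (lift ord0 i))%N.
    rewrite nth_mkseq//; suff -> : inord i.+1 = lift ord0 i :> 'I_d.+1 by [].
    by apply/val_inj; rewrite /= inordK// ltnS ltn_ord.
  have ptx : pt t (m ord0 - a ord0)%N = x.
    rewrite /pt [RHS](coord_sum bsP); apply: eq_bigr => j _; congr (_ *: _).
    rewrite mE; congr _%:R; case: (unliftP ord0 j) => [i ->|->]; last by rewrite /= subnKC.
    by rewrite lift0 [nth _ _ _]/= tn subnKC.
  have iE : iota x = L + (m ord0 - a ord0)%N%:R + dot t ratios by rewrite -ptx ipt.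
  have tX : dot t ratios < X.
    move: eE; rewrite iE /X; have := ler0n R (m ord0 - a ord0)%N; lra.
  exists t; first by rewrite mem_simplex_points ?ratios_gt0// size_ratios td eqxx.
  rewrite /f -ptx; congr (iota (pt _ _)); apply/eqP; rewrite -(eqr_nat R) m0E//.
  rewrite -[(m ord0 - a ord0)%N%:R]/((Posz (m ord0 - a ord0)%N)%:~R) eqr_int eq_sym; apply/eqP.
  apply: ceil_def; rewrite intrB /=; move: Ee eE; rewrite iE -pmulrn => h1 h2.
  by apply/andP; split; lra.
case=> t tX ->; split; last first.
  apply/mem_window; split; last exact: ptw.
  by apply/energy_levelP; exists (pt t (m0 t)).
apply/asboolP; exists (pt t (m0 t)); split=> // j.
by rewrite cpt ratr_nat ler_nat leq_addr.
Qed.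

Hypothesis d_gt0 : (0 < d)%N.

Local Notation vol := (simplex_cst ratios).
Let W : R := \sum_(w <- ratios) w.
Definition count_err : R := vol * (d%:R * (2 + W) ^+ d.-1 * (1 + W)).

Lemma vol_gt0 : 0 < vol.
Proof.
rewrite divr_gt0 ?ltr0n ?fact_gt0// invr_gt0 big_seq prodr_gt0// => w.
exact: (allP ratios_gt0).
Qed.

Let W_ge0 : 0 <= W.
Proof. by rewrite /W big_seq sumr_ge0// => w /(allP ratios_gt0)/ltW. Qed.

Lemma count_err_ge0 : 0 <= count_err.
Proof.
apply: mulr_ge0; first exact/ltW/vol_gt0.
apply: mulr_ge0; last by rewrite addr_ge0// W_ge0.
by rewrite mulr_ge0// exprn_ge0// addr_ge0// W_ge0.
Qed.

(** Both bounds of size_simplex_points are taken at arguments that differ by O(1) from X, and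
    the power is Lipschitz after division by E. *)
Lemma size_simplex_near X E : 1 < E -> X <= E ->
  `|(size (simplex_points ratios (X + 1)))%:R / E ^+ d - vol * pos (X / E) ^+ d| <= count_err / E.
Proof.
move=> E1 XE; have E0 := lt_trans ltr01 E1; have Ed0 : 0 < E ^+ d by rewrite exprn_gt0.
have W0 := W_ge0; have v0 := ltW vol_gt0.
have dE : d = d.-1.+1 by rewrite prednK.
have posE Y : pos (Y / E) ^+ d = pos Y ^+ d / E ^+ d.
  rewrite -expr_div_n; congr (_ ^+ d); have [Y0|Y0] := leP 0 Y.
    by rewrite !ger0_pos// divr_ge0// ltW.
  by rewrite !ler0_pos ?mul0r ?ltW// pmulr_llt0// invr_gt0.
have ex0 : 0 ^+ d = 0 :> R by rewrite dE expr0n.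
have [lo up] : vol * pos X ^+ d <= (size (simplex_points ratios (X + 1)))%:R /\
    (size (simplex_points ratios (X + 1)))%:R <= vol * pos (X + 1 + W) ^+ d.
  have [X0|X0] := leP (X + 1) 0.
    rewrite simplex_points0 ?ratios_gt0// ler0_pos ?ex0 ?mulr0; last by lra.
    by rewrite mulr_ge0// exprn_ge0// pos_ge0.
  have [/(_ X0) h1 /(_ X0) h2] := size_simplex_points (X + 1) ratios_gt0.
  rewrite size_ratios -/W in h1 h2; split.
    apply: le_trans h1; rewrite ler_wpM2l// lerXn2r ?nnegrE ?pos_ge0 ?(ltW X0)//.
    by rewrite -(ger0_pos (ltW X0)) le_pos// lerDl.
  by rewrite ger0_pos// addr_ge0// ltW.
have h3 : pos (X + 1 + W) ^+ d / E ^+ d - pos (X / E) ^+ d <= d%:R * (2 + W) ^+ d.-1 * ((1 + W) / E).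
  rewrite -posE; set a := (X + 1 + W) / E; set b := X / E.
  have ab : a - b = (1 + W) / E by rewrite /a /b; field; rewrite gt_eqF.
  have ab0 : 0 <= a - b by rewrite ab divr_ge0 ?addr_ge0// ltW.
  have b1 : b <= 1 by rewrite ler_pdivrMr// mul1r.
  have w1 : (1 + W) / E <= 1 + W by rewrite ler_pdivrMr// ler_peMr ?addr_ge0// ltW.
  have M0 : 0 <= 2 + W by rewrite addr_ge0.
  have aM : a <= 2 + W by lra.
  have bM : b <= 2 + W by lra.
  have := @pos_exp_lip _ d.-1 (2 + W) a b aM bM M0.
  by rewrite -dE (ger0_norm ab0) ab => /ler_normlW.
have lo' : vol * pos (X / E) ^+ d <= (size (simplex_points ratios (X + 1)))%:R / E ^+ d.
  by rewrite posE mulrA ler_pM2r ?invr_gt0.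
have up' : (size (simplex_points ratios (X + 1)))%:R / E ^+ d <= vol * (pos (X + 1 + W) ^+ d / E ^+ d).
  by rewrite mulrA ler_pM2r ?invr_gt0.
rewrite ger0_norm ?subr_ge0//.
have -> : count_err / E = vol * (d%:R * (2 + W) ^+ d.-1 * ((1 + W) / E)).
  by rewrite /count_err; ring.
apply: (@le_trans _ _ (vol * (pos (X + 1 + W) ^+ d / E ^+ d - pos (X / E) ^+ d))).
  by rewrite mulrBr; apply: lerB.
by rewrite ler_wpM2l.
Qed.

Lemma size_window E :
  size (window E) = size (simplex_points ratios (E + 1)).
Proof.
have := count_above (fun=> 0%N) E.
rewrite big1 ?subr0 => [<-|j _]; last by rewrite mul0r.
apply/esym/eqP; rewrite -all_count; apply/allP => e.
move=> /mem_window[/energy_levelP[x xl ->] _]; apply/asboolP; exists x; split=> // j.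
by have /(levelP R)[_] := xl; apply.
Qed.

Lemma window_size_near E : 1 < E ->
  `|(size (window E))%:R / E ^+ d - vol| <= count_err / E.
Proof.
move=> E1; have E0 := lt_trans ltr01 E1; rewrite size_window.
have := size_simplex_near E1 (lexx E).
by rewrite divff ?gt_eqF// ger0_pos ?ler01// expr1n mulr1.
Qed.

Lemma window_size_gt1 : exists E0, forall E, E0 < E -> (1 < size (window E))%N.
Proof.
exists ((2 + count_err) / vol + 1) => E EE.
have v0 := vol_gt0; have ce0 := count_err_ge0.
have E1 : 1 < E by apply: le_lt_trans EE; rewrite lerDr divr_ge0// ?addr_ge0// ltW.
have E0 := lt_trans ltr01 E1; have Ed0 : 0 < E ^+ d by rewrite exprn_gt0.
have EdE : E <= E ^+ d by rewrite -[leLHS]expr1 ler_weXn2l// ltW.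
have := window_size_near E1; rewrite ler_norml => /andP[h _].
have h1 : (2 + count_err) / E < vol.
  rewrite ltr_pdivrMr// mulrC -ltr_pdivrMr//; apply: le_lt_trans EE.
  by rewrite lerDl ler01.
have h2 : 2 / E < (size (window E))%:R / E ^+ d by move: h1; rewrite mulrDl; lra.
rewrite -(ltr_nat R); have : 1 < 2 :> R by lra.
move=> /lt_trans; apply; move: h2; rewrite ltr_pdivlMr// => /le_lt_trans; apply.
by rewrite -mulrA ler_peMr// mulrC ler_pdivlMr// mul1r.
Qed.

(** The rescaling unit at scale [E] is [su E]; [dist] bounds, up to terms in 1/E,
    how much its inverse divided by [E] varies between two scales. *)
Context (su : R -> Phi) (dist : R -> R -> R).
Hypothesis suU : forall E, lattice_unit bs (su E).
Hypothesis su_gt0 : forall E, 0 < iota (su E).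
Hypothesis dist_ge0 : forall E E', 0 <= dist E E'.

Definition approx_lip (h : R -> R) : Prop := exists2 C, 0 <= C &
  forall E E', 1 < E -> 1 < E' -> `|h E - h E'| <= C * (dist E E' + (E^-1 + E'^-1)).

Hypothesis su_lip : forall p j, approx_lip (fun E => co (p / su E) j / E).

Lemma approx_lip_dominated (I : Type) (r : seq I) (w : I -> R) (h : R -> R) (f : I -> R -> R) :
  (forall i, 0 <= w i) -> (forall i, approx_lip (f i)) ->
  (forall E E', 1 < E -> 1 < E' ->
    `|h E - h E'| <= \sum_(i <- r) w i * `|f i E - f i E'|) ->
  approx_lip h.
Proof.
move=> w0 /(_ _)/cid2 fl hf; exists (\sum_(i <- r) w i * s2val (fl i)).
  by apply: sumr_ge0 => i _; rewrite mulr_ge0//; case: (fl i).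
move=> E E' E1 E'1; apply: le_trans (hf _ _ E1 E'1) _; rewrite mulr_suml.
apply: ler_sum => i _; rewrite -mulrA ler_wpM2l//.
by case: (fl i) => /= C C0; apply.
Qed.

Lemma approx_lip_near (h h' : R -> R) C : (forall E, 1 < E -> `|h E - h' E| <= C / E) ->
  approx_lip h' -> approx_lip h.
Proof.
move=> hh' [C' C'0 h'l]; exists (`|C| + C'); first by rewrite addr_ge0.
move=> E E' E1 E'1; have := h'l _ _ E1 E'1; have := hh' _ E1; have := hh' _ E'1.
have inv0 (x : R) : 1 < x -> 0 < x^-1 by move=> x1; rewrite invr_gt0 (lt_trans ltr01).
have h1 : C / E <= `|C| * E^-1 by rewrite ler_wpM2r ?ler_norm// ltW// inv0.
have h2 : C / E' <= `|C| * E'^-1 by rewrite ler_wpM2r ?ler_norm// ltW// inv0.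
have h3 : 0 <= `|C| * dist E E' by rewrite mulr_ge0.
rewrite mulrDl [`|C| * _]mulrDr [`|C| * (_ + _)]mulrDr.
rewrite !ler_norml => /andP[a1 a2] /andP[a3 a4] /andP[a5 a6].
by apply/andP; split; lra.
Qed.

(** The shift p / su E is the candidate gap that rescales to p. *)
Definition shift_level E (e : R) (p : Phi) : bool :=
  `[< energy_levels omega (e + iota p / iota (su E)) >].

Definition pattern E (Pos Neg : seq Phi) (e : R) : bool :=
  all (shift_level E e) Pos && all (fun q => ~~ shift_level E e q) Neg.

Definition pattern_count (Pos Neg : seq Phi) (E : R) : R :=
  (count (pattern E Pos Neg) (window E))%:R.

(** The j-th coordinate of the corner of the intersection of the positive orthant with its
    translates by the opposites of the shifts. *)
Definition offset (Pos : seq Phi) E j : R :=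
  \big[Num.max/0]_(p <- Pos) (- co (p / su E) j).

Lemma offset_le Pos E j (y : R) : (offset Pos E j <= y) =
  (0 <= y) && all (fun p => - co (p / su E) j <= y) Pos.
Proof.
rewrite /offset; elim: Pos => [|p Pos IH]; first by rewrite big_nil andbT.
by rewrite big_cons ge_max IH /= andbCA.
Qed.

Lemma offset_nat Pos E : {subset Pos <= lattice bs} ->
  exists a : 'I_d.+1 -> nat, forall j, (a j)%:R = offset Pos E j.
Proof.
move=> PL; exists (fun j => Num.truncn (offset Pos E j)) => j.
suff [n ->] : exists n : nat, offset Pos E j = n%:R by rewrite natrK.
rewrite /offset; elim: Pos PL => [|p Pos IH] PL.
  by exists 0%N; rewrite big_nil.
have [n nE] := IH (fun q qP => PL q (mem_behead (s := p :: Pos) qP)); rewrite big_cons nE.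
have /latticeP/(_ j)/intrP[m ->] : p / su E \in lattice bs.
  by apply: latticeM; rewrite ?PL ?mem_head//; have /and3P[] := suU E.
rewrite ratr_int -intrN; case: (- m) => k.
  by exists (maxn k n); rewrite -pmulrn natr_max.
by exists n; rewrite max_r// (le_trans (_ : _ <= 0))// NegzE mulrNz oppr_le0 ler0z.
Qed.

Lemma count_shifted Pos E : {subset Pos <= lattice bs} ->
  pattern_count Pos [::] E =
    (size (simplex_points ratios (E + 1 - \sum_(j < d.+1) offset Pos E j * om j)))%:R.
Proof.
move=> PL; have [a aE] := offset_nat E PL.
rewrite (eq_bigr (fun j : 'I_d.+1 => (a j)%:R * om j)); last by move=> j _; rewrite aE.
rewrite -count_above /pattern_count; congr _%:R; apply: eq_in_count => e.
move=> /mem_window[/energy_levelP[x xl ->] _]; rewrite /pattern andbT.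
have shiftE p : iota x + iota p / iota (su E) = iota (x + p / su E).
  by rewrite rmorphD fmorph_div.
have shiftP p : p \in Pos -> shift_level E (iota x) p =
    [forall j, - co (p / su E) j <= co x j].
  move=> pP; have pL : p / su E \in lattice bs.
    by apply: latticeM; rewrite ?PL//; have /and3P[] := suU E.
  apply/asboolP/forallP => [/energy_levelP[y /(levelP R)[_ yp]] /eqP|H].
    rewrite shiftE => /eqP/fmorph_inj yE j; have := yp j.
    by rewrite -yE linearD rmorphD /= -lerBlDr sub0r.
  apply/energy_levelP; exists (x + p / su E); last exact: shiftE.
  have /(levelP R)[xL _] := xl.
  apply/(levelP R); split=> [|j]; first by rewrite rpredD.
  by have := H j; rewrite linearD rmorphD /= -lerBlDr sub0r.
apply/allP/asboolP => [H|[y [yl /fmorph_inj <- ya]] p pP].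
  exists x; split=> // j; rewrite aE offset_le; apply/andP; split.
    by have /(levelP R)[_] := xl; apply.
  by apply/allP => p pP; have := H p pP; rewrite shiftP// => /forallP; apply.
rewrite shiftP//; apply/forallP => j; have := ya j; rewrite aE offset_le.
by case/andP=> _ /allP; apply.
Qed.

(** Excluding a shift is a difference of two counts with one excluded shift less; iterating
    this is the inclusion-exclusion formula. *)
Lemma pattern_countN Pos q Neg E :
  pattern_count Pos (q :: Neg) E = pattern_count Pos Neg E - pattern_count (q :: Pos) Neg E.
Proof.
apply/eqP; rewrite eq_sym subr_eq /pattern_count -natrD eqr_nat; apply/eqP.
rewrite -(count_predUI) addnC [X in (X + _)%N](eq_count (a2 := pred0)) ?count_pred0.
  rewrite add0n; apply: eq_count => e; rewrite /= /pattern /=.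
  by case: (shift_level E e q); case: (all _ Pos); case: (all _ Neg).
move=> e; rewrite /= /pattern /=.
by case: (shift_level E e q); case: (all _ Pos); case: (all _ Neg).
Qed.

Lemma offset_ge0 Pos E j : 0 <= offset Pos E j.
Proof. by have := lexx (offset Pos E j); rewrite offset_le => /andP[]. Qed.

Definition total_offset Pos E : R := \sum_(j < d.+1) offset Pos E j * om j.

Lemma total_offset_ge0 Pos E : 0 <= total_offset Pos E.
Proof. by apply: sumr_ge0 => j _; rewrite mulr_ge0 ?offset_ge0// ltW. Qed.

(** By size_simplex_near the normalized count is a power of 1 - T / E, with T the value of iota
    at the corner; T is a combination of maxima of coordinates of the shifts, which vary in
    a Lipschitz way with the scale. *)
Lemma approx_lip_count Pos : {subset Pos <= lattice bs} ->
  approx_lip (fun E => pattern_count Pos [::] E / E ^+ d).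
Proof.
move=> PL.
apply: (@approx_lip_near _ (fun E => vol * pos ((E - total_offset Pos E) / E) ^+ d) count_err).
  move=> E E1; rewrite count_shifted// -/(total_offset Pos E).
  rewrite addrAC; apply: size_simplex_near => //.
  by rewrite gerBl total_offset_ge0.
have offl j : approx_lip (fun E => offset Pos E j / E).
  apply: (@approx_lip_dominated _ Pos (fun=> 1) _ (fun p E => co (p / su E) j / E)) => [//|p|E E' E1 E'1].
    exact: su_lip.
  have E0 := lt_trans ltr01 E1; have E'0 := lt_trans ltr01 E'1.
  rewrite /offset; elim: Pos {PL} => [|p Pos IH].
    by rewrite !big_nil !mul0r subrr normr0.
  rewrite !big_cons !maxr_pMl ?invr_ge0 ?(ltW E0) ?(ltW E'0)// mul1r.
  set a := - _ / _; set a' := - _ / _; set b := _ / _ in IH *; set b' := _ / _ in IH *.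
  have -> : `|co (p / su E) j / E - co (p / su E') j / E'| = `|a - a'|.
    by rewrite /a /a' !mulNr -opprD normrN.
  apply: (@le_trans _ _ (`|a - a'| + `|b - b'|)); last by rewrite lerD2l.
  rewrite !maxEle; case: (leP a b) => ab; case: (leP a' b') => ab'.
  - by rewrite lerDr.
  - move: (ler_norm (a - a')) (ler_norm (a' - a)) (ler_norm (b - b')) (ler_norm (b' - b)).
    rewrite [`|a' - a|]distrC [`|b' - b|]distrC ler_norml => *; apply/andP; split; lra.
  - move: (ler_norm (a - a')) (ler_norm (a' - a)) (ler_norm (b - b')) (ler_norm (b' - b)).
    rewrite [`|a' - a|]distrC [`|b' - b|]distrC ler_norml => *; apply/andP; split; lra.
  - by rewrite lerDl.
have totl : approx_lip (fun E => total_offset Pos E / E).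
  apply: (@approx_lip_dominated _ (index_enum 'I_d.+1) (fun j : 'I_d.+1 => om j) _ (fun j E => offset Pos E j / E)) => [j|j|E E' E1 E'1].
  - exact: ltW.
  - exact: offl.
  rewrite /total_offset !mulr_suml -sumrB.
  apply: le_trans (ler_norm_sum _ _ _) _; apply: ler_sum => j _.
  have -> : offset Pos E j * om j / E - offset Pos E' j * om j / E' =
     om j * (offset Pos E j / E - offset Pos E' j / E') by ring.
  by rewrite normrM gtr0_norm.
apply: (@approx_lip_dominated _ [:: tt] (fun=> vol * d%:R) _ (fun=> fun E => total_offset Pos E / E)) => [_|_|E E' E1 E'1].
- by rewrite mulr_ge0// ltW// vol_gt0.
- exact: totl.
have E0 := lt_trans ltr01 E1; have E'0 := lt_trans ltr01 E'1.
rewrite big_cons big_nil addr0 -mulrBr normrM gtr0_norm ?vol_gt0// -mulrA.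
rewrite ler_wpM2l ?(ltW vol_gt0)//.
have le1 F : 0 < F -> (F - total_offset Pos F) / F <= 1.
  by move=> F0; rewrite ler_pdivrMr// mul1r gerBl total_offset_ge0.
have := @pos_exp_lip _ d.-1 1 _ _ (le1 E E0) (le1 E' E'0) ler01.
rewrite expr1n mulr1 prednK// => /le_trans; apply; rewrite ler_wpM2l//.
by rewrite !mulrBl !divff ?gt_eqF// opprB addrC addrA subrK distrC.
Qed.

Lemma approx_lipB h h' : approx_lip h -> approx_lip h' -> approx_lip (fun E => h E - h' E).
Proof.
move=> hl h'l; apply: (@approx_lip_dominated _ [:: true; false] (fun=> 1) _ (fun t : bool => if t then h else h')).
- by [].
- by case.
- move=> E E' _ _; rewrite !big_cons big_nil !mul1r addr0.
  have -> : h E - h' E - (h E' - h' E') = (h E - h E') - (h' E - h' E') by ring.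
  exact: ler_normB.
Qed.

Lemma approx_lip_pattern Pos Neg : {subset Pos <= lattice bs} -> {subset Neg <= lattice bs} ->
  approx_lip (fun E => pattern_count Pos Neg E / E ^+ d).
Proof.
elim: Neg Pos => [|q Neg IH] Pos PL NL; first exact: approx_lip_count.
have NL' : {subset Neg <= lattice bs} by move=> x xN; rewrite NL// inE xN orbT.
have /approx_lipB := IH Pos PL NL'; move=> /(_ (fun E => pattern_count (q :: Pos) Neg E / E ^+ d)).
case.
  apply: IH => // x; rewrite inE => /orP[/eqP ->|/PL//].
  by rewrite NL// mem_head.
move=> C C0 hC; exists C => // E E' E1 E'1; rewrite !pattern_countN !mulrBl.
exact: hC.
Qed.

(** * Proportions of the rescaled spacings *)

Context (S : seq Phi).
Hypothesis S_lattice : {subset S <= lattice bs}.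
Hypothesis spacing_S : forall E x y, 1 < E -> level x -> level y ->
  E <= iota x -> iota x < iota y -> iota y < E + 1 ->
  (forall z, level z -> iota x < iota z -> iota y <= iota z) -> su E * (y - x) \in S.

Local Notation spaced := (rescaled_spacings omega (fun E => iota (su E))).

Lemma window_next E i e : (i.+1 < size (window E))%N -> energy_levels omega e ->
  (window E)`_i < e -> (window E)`_i.+1 <= e.
Proof.
move=> iw el ie; have [ws wP] := window_levelsP E omega_gt0.
have w_in k : (k < size (window E))%N -> E <= (window E)`_k < E + 1.
  by move=> kw; have [] := (wP _).1 (mem_nth 0 kw).
rewrite leNgt; apply/negP => ei.
have : e \in window E.
  apply/wP; split=> //; have /andP[h1 _] := w_in i (ltnW iw).
  have /andP[_ h2] := w_in i.+1 iw; rewrite (le_trans h1 (ltW ie)) (lt_trans ei h2).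
  by [].
case/(nthP 0) => k kw kE; move: ie ei; rewrite -kE.
by rewrite !(lt_sorted_ltn_nth 0 ws) ?inE// ?(ltnW iw)// => h1; rewrite ltnS leqNgt h1.
Qed.

Lemma spaced_S E i : 1 < E -> (i.+1 < size (window E))%N ->
  exists s, [/\ s \in S, 0 < iota s &
    iota (su E) * ((window E)`_i.+1 - (window E)`_i) = iota s].
Proof.
move=> E1 iw; have [ws wP] := window_levelsP E omega_gt0.
have /wP[/energy_levelP[x xl xE] /andP[Ex _]] := mem_nth 0 (ltnW iw).
have /wP[/energy_levelP[y yl yE] /andP[_ yE1]] := mem_nth 0 iw.
have xy : iota x < iota y by rewrite -xE -yE (lt_sorted_ltn_nth 0 ws) ?inE// ltnW.
exists (su E * (y - x)); split.
- apply: spacing_S => //; rewrite -?xE -?yE// => z zl xz.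
  by apply: window_next => //; apply/energy_levelP; exists z.
- by rewrite rmorphM mulr_gt0// rmorphB subr_gt0.
- by rewrite rmorphM rmorphB xE yE.
Qed.

(** The gaps that have to be excluded for s to be the gap. *)
Definition smaller (s : Phi) : seq Phi := [seq q <- S | 0 < iota q < iota s].

(** The actual rescaled gap s' belongs to S.  If s leads to a level, then s' is at most s, as
    no level lies between consecutive ones; if moreover no smaller element of S leads to a
    level, then s' is not smaller than s. *)
Lemma spacing_pattern E i s : 1 < E -> (i.+1 < size (window E))%N ->
  s \in S -> 0 < iota s ->
  (iota (su E) * ((window E)`_i.+1 - (window E)`_i) == iota s) =
  pattern E [:: s] (smaller s) (window E)`_i.
Proof.
move=> E1 iw sS s0; have [ws wP] := window_levelsP E omega_gt0.
have u0 := su_gt0 E; have u_neq0 : iota (su E) != 0 by rewrite gt_eqF.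
set w0 := (window E)`_i; set w1 := (window E)`_i.+1.
have w1l : energy_levels omega w1 by have /wP[] := mem_nth 0 iw.
have [s' [s'S s'0 s'E]] := spaced_S E1 iw; rewrite -/w0 -/w1 in s'E.
have w1E : w1 = w0 + iota s' / iota (su E).
  by rewrite -s'E mulrAC divff// mul1r addrC subrK.
have nextP q : 0 < iota q -> shift_level E w0 q -> iota s' <= iota q.
  move=> q0 /asboolP ql; have := window_next iw ql; rewrite -/w0 -/w1 ltrDl.
  by rewrite divr_gt0// w1E lerD2l ler_pM2r ?invr_gt0// => /(_ isT).
rewrite s'E /pattern /= andbT; apply/eqP/andP => [sE|[sl /allP sn]].
  have ss : s' = s by exact: (fmorph_inj iota).
  rewrite ss in nextP w1E; split; last first.
    apply/allP => q; rewrite mem_filter => /andP[/andP[q0 qs] _].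
    by apply: contraL qs => ql; rewrite -leNgt nextP.
  by apply/asboolP; rewrite -w1E.
apply/eqP; rewrite eq_le nextP//= leNgt; apply/negP => s's.
have /sn : s' \in smaller s by rewrite mem_filter s'0 s's.
by rewrite /shift_level -w1E; case: asboolP.
Qed.

Lemma size_spaced E : size (spaced E) = (size (window E)).-1.
Proof. by rewrite !size_map size_iota. Qed.

(** The top level of the window is followed by no spacing of the window, but it may have the
    pattern: this is the difference of at most 1. *)
Lemma count_spaced E s : 1 < E -> s \in S -> 0 < iota s ->
  (count_mem (iota s) (spaced E))%:R <= pattern_count [:: s] (smaller s) E
    <= (count_mem (iota s) (spaced E))%:R + 1.
Proof.
move=> E1 sS s0; rewrite /rescaled_spacings /spacings !count_map.
set P := pattern E [:: s] (smaller s).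
rewrite (@eq_in_count _ _ (fun i => P (window E)`_i)); last first.
  move=> i; rewrite mem_iota add0n /= ltn_predRL => iw.
  exact: spacing_pattern.
rewrite /pattern_count -/P -{3 4}(mkseq_nth 0 (window E)) count_map.
case: (size _) => [|n]; first by rewrite /= lexx lerDl ler01.
rewrite [n.+1.-1]/= -addn1 iotaD count_cat add0n /= addn0 natrD lerDl ler0n lerD2l.
by case: (P _); rewrite ?lexx ?ler01.
Qed.

Lemma count_spaced0 E s : 1 < E -> ~~ (0 < iota s) -> count_mem (iota s) (spaced E) = 0%N.
Proof.
move=> E1 s0; rewrite /rescaled_spacings /spacings !count_map.
rewrite (@eq_in_count _ _ pred0) ?count_pred0// => i; rewrite mem_iota add0n /= ltn_predRL => iw.
have [s' [_ s'0 ->]] := spaced_S E1 iw.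
by apply: contraNF s0 => /eqP <-.
Qed.

(** The proportion differs by O(1/E) from the normalized count divided by the volume: the number
    of spacings is within O(E^(d - 1)) of the volume times E^d, and the counts of spacings
    and of patterns differ by at most 1. *)
Lemma proportion_lip s : s \in S ->
  approx_lip (fun E => proportion (spaced E) (iota s)).
Proof.
move=> sS; have v0 := vol_gt0.
have ce0 := count_err_ge0.
have [s0|s0] := boolP (0 < iota s); last first.
  exists 0 => // E E' E1 E'1; rewrite /proportion !count_spaced0//.
  by rewrite !mul0r subrr normr0.
have smallL : {subset smaller s <= lattice bs}.
  by move=> q; rewrite mem_filter => /andP[_ /S_lattice].
have PL : {subset [:: s] <= lattice bs} by move=> q; rewrite inE => /eqP ->; exact: S_lattice.
have pl := approx_lip_pattern PL smallL.
apply: (@approx_lip_near _ (fun E => vol^-1 * (pattern_count [:: s] (smaller s) E / E ^+ d)) (vol^-1 * (count_err + 2))).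
  move=> E E1; have E0 := lt_trans ltr01 E1.
  have Ed0 : 0 < E ^+ d by rewrite exprn_gt0.
  have EdE : E <= E ^+ d by rewrite -[leLHS]expr1 ler_weXn2l// ltW.
  have := window_size_near E1; have := count_spaced E1 sS s0; rewrite /proportion size_spaced.
  have : (count_mem (iota s) (spaced E) <= (size (window E)).-1)%N.
    by rewrite -size_spaced count_size.
  set G := count_mem _ _; set F := pattern_count _ _ _; set l := size _.
  move=> Gl /andP[FG1 FG2] lE.
  have G1 : (G%:R : R) / l.-1%:R <= 1.
    case: (l.-1) Gl => [|n] Gl; first by rewrite invr0 mulr0.
    by rewrite ler_pdivrMr ?ltr0n// mul1r ler_nat.
  have G0 : 0 <= (G%:R : R) / l.-1%:R by rewrite divr_ge0.
  (* The three terms: error on the number of levels, removal of the top level, and its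
     possible contribution to the count of patterns. *)
  have -> : G%:R / l.-1%:R - vol^-1 * (F / E ^+ d) =
     vol^-1 * ((G%:R / l.-1%:R) * (vol - l%:R / E ^+ d)
        + (G%:R / l.-1%:R * (l%:R - l.-1%:R)) / E ^+ d + (G%:R - F) / E ^+ d).
    have [l0|l0] := eqVneq (l.-1%:R : R) 0.
      have -> : G = 0%N.
        by apply/eqP; rewrite -leqn0 (leq_trans Gl)// leqn0 -(pnatr_eq0 R) l0.
      by rewrite l0 invr0 !mul0r sub0r !add0r; ring.
    by field; rewrite l0 !gt_eqF.
  have ll : 0 <= (l%:R : R) - l.-1%:R <= 1.
    case: (l) => [|n] /=; first by rewrite subrr lexx ler01.
    by rewrite -natr1 addrC addKr ler01 lexx.
  rewrite normrM gtr0_norm ?invr_gt0// -[leRHS]mulrA ler_wpM2l ?invr_ge0 ?(ltW v0)//.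
  have EdV : (E ^+ d)^-1 <= E^-1 by rewrite lef_pV2.
  have h1 : `|G%:R / l.-1%:R * (vol - l%:R / E ^+ d)| <= count_err / E.
    rewrite normrM (ger0_norm G0) -[leRHS]mul1r distrC ler_pM//.
  have h2 : `|(G%:R / l.-1%:R * (l%:R - l.-1%:R)) / E ^+ d| <= E^-1.
    case/andP: ll => ll0 ll1.
    rewrite normrM normfV (gtr0_norm Ed0) -[leRHS]mul1r ler_pM ?invr_ge0 ?(ltW Ed0)//.
    by rewrite normrM !ger0_norm// mulr_ile1.
  have h3 : `|(G%:R - F) / E ^+ d| <= E^-1.
    rewrite normrM normfV (gtr0_norm Ed0) -[leRHS]mul1r ler_pM ?invr_ge0 ?(ltW Ed0)//.
    by rewrite ler_norml; apply/andP; split; lra.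
  have -> : (count_err + 2) / E = count_err / E + E^-1 + E^-1 by ring.
  apply: le_trans (ler_normD _ _) _; apply: lerD h3.
  exact: le_trans (ler_normD _ _) (lerD h1 h2).
apply: (@approx_lip_dominated _ [:: tt] (fun=> vol^-1) _ (fun=> fun E => pattern_count [:: s] (smaller s) E / E ^+ d)) => [_|_|E E' _ _].
- by rewrite invr_ge0 ltW.
- exact: pl.
- by rewrite big_cons big_nil addr0 -mulrBr normrM gtr0_norm ?invr_gt0.
Qed.

Lemma proportion_ge0 E x : 0 <= proportion (spaced E) x.
Proof. by rewrite divr_ge0. Qed.

Lemma sum_proportion E (s : seq Phi) : 1 < E -> (1 < size (window E))%N ->
  uniq s -> s =i S -> \sum_(q <- s) proportion (spaced E) (iota q) = 1.
Proof.
move=> E1 lE su_ sS; rewrite -mulr_suml -natr_sum.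
have -> : (\sum_(q <- s) count_mem (iota q) (spaced E))%N = size (spaced E).
  have : all [in map iota s] (spaced E).
    apply/allP => _ /mapP[_ /mapP[i iw ->] ->].
    move: iw; rewrite mem_iota add0n /= ltn_predRL => iw.
    have [q [qS _ ->]] := spaced_S E1 iw.
    by apply: map_f; rewrite sS.
  elim: (spaced E) => [|x xs IH] /=; first by rewrite big1.
  move=> /andP[/mapP[q qs xq] /IH <-]; rewrite big_split /=.
  rewrite -add1n; congr (_ + _)%N; rewrite (bigD1_seq q)//= xq eqxx big1 => [|q' q'q]; first by rewrite addn0.
  by rewrite (inj_eq (fmorph_inj iota)) eq_sym (negPf q'q).
rewrite divff// size_spaced pnatr_eq0 -lt0n.
by rewrite ltn_predRL.
Qed.

End Levels.

(** * Quasiperiodicity *)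

Lemma rV_norm_le (R : realType) (n : nat) (v : 'rV[R]_n) (M : R) :
  0 <= M -> (forall i, `|v 0 i| <= M) -> `|v| <= M.
Proof.
move=> M0 vM; rewrite [`|v|]mx_normrE; apply: bigmax_le => // -[i j] _ /=.
by rewrite (ord1 i).
Qed.

Lemma rV_norm_ge (R : realType) (n : nat) (v : 'rV[R]_n) i : `|v 0 i| <= `|v|.
Proof. by rewrite [`|v|]mx_normrE; exact: (le_bigmax _ _ (0, i)). Qed.

Section QuasiperiodicExtension.
Context (R : realType) (n r J : nat) (j0 : 'I_J).
Context (theta : 'rV[R]_n) (beta : 'rV[R]_r).

Let X : Type := ('rV[circle R]_n * 'rV[R]_r)%type.

(** A pseudometric dominated by the product metric, for which the triangle inequality is that
    of the modulus. *)
Definition torus_cube_dist (x y : X) : R :=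
  \sum_l cabs (circle_char (x.1 0 l) - circle_char (y.1 0 l)) +
  \sum_i `|x.2 0 i - y.2 0 i|.

Definition log_orbit (E : R) : X :=
  (to_torus (ln E *: theta), map_mx (@frac_part R) (ln E *: beta)).

Lemma torus_cube_dist_ge0 x y : 0 <= torus_cube_dist x y.
Proof.
by rewrite addr_ge0// ?sumr_ge0// => i _; exact: cabs_ge0.
Qed.

Lemma torus_cube_dist_le a a' b b' :
  torus_cube_dist (a, b) (a', b') <=
  (n%:R * (4 * pi) + r%:R) * Num.max (torus_dist a a') `|b - b'|.
Proof.
rewrite mulrDl; apply: lerD.
  have -> : n%:R * (4 * pi) * Num.max (torus_dist a a') `|b - b'| =
      \sum_(l < n) 4 * pi * Num.max (torus_dist a a') `|b - b'|.
    by rewrite sumr_const card_ord -[LHS]mulrA [LHS]mulr_natl.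
  apply: ler_sum => l _; apply: le_trans (circle_char_lip _ _) _.
  rewrite ler_wpM2l ?mulr_ge0 ?pi_ge0// le_max; apply/orP; left.
  exact: (le_bigmax _ (fun i => circle_dist (a 0 i) (a' 0 i)) l).
have -> : r%:R * Num.max (torus_dist a a') `|b - b'| =
    \sum_(i < r) Num.max (torus_dist a a') `|b - b'|.
  by rewrite sumr_const card_ord mulr_natl.
apply: ler_sum => i _ /=; rewrite le_max; apply/orP; right.
have -> : b 0 i - b' 0 i = (b - b') 0 i by rewrite !mxE.
exact: rV_norm_ge.
Qed.

(** Each coordinate is extended by mcshane_approx, and the result is retracted onto the simplex;
    on the orbit the retraction does not increase the error by more than its Lipschitz
    constant, because it fixes the data. *)
Lemma quasiperiodic_extension (p : 'I_J -> R -> R) (E0 : R) :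
  (forall j E, 0 <= p j E) ->
  (forall E, E0 < E -> \sum_j p j E = 1) ->
  (forall j, exists2 C, 0 <= C & forall E E', 1 < E -> 1 < E' ->
    `|p j E - p j E'| <=
      C * (torus_cube_dist (log_orbit E) (log_orbit E') + (E^-1 + E'^-1))) ->
  exists g : 'rV[circle R]_n * 'rV[R]_r -> 'rV[R]_J,
    [/\ forall a b, prob_simplex (g (a, b)),
        torus_cube_lipschitz g &
        exists C : R, forall E, 1 < E -> E0 < E -> forall j,
          `|p j E - g (log_orbit E) 0 j| <= C / E].
Proof.
move=> p0 p1 /(_ _)/cid2 pl; pose K := \sum_j s2val (pl j).
have C0 j : 0 <= s2val (pl j) by case: (pl j).
have K0 : 0 <= K by exact: sumr_ge0.
have pK j E E' : 1 < E -> 1 < E' -> `|p j E - p j E'| <=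
    K * torus_cube_dist (log_orbit E) (log_orbit E') + K / E + K / E'.
  move=> E1 E'1; rewrite -addrA -mulrDr -mulrDr.
  have := s2valP' (pl j) _ _ E1 E'1 => /le_trans; apply.
  rewrite ler_wpM2r//; last by rewrite /K (bigD1 j)//= lerDl sumr_ge0.
  apply: addr_ge0; first exact: torus_cube_dist_ge0.
  by apply: addr_ge0; rewrite invr_ge0 ltW// (lt_trans ltr01).
have /(_ _)/cid gP j : exists g : X -> R,
    (forall x y, `|g x - g y| <= K * torus_cube_dist x y) /\
    forall t : {E : R | 1 < E}, `|g (log_orbit (sval t)) - p j (sval t)| <= K / sval t.
  have t0 : {E : R | 1 < E} by exists 2; rewrite ltr1n.
  apply: (@mcshane_approx R {E : R | 1 < E} X (fun x y => K * torus_cube_dist x y)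
    (fun t => log_orbit (sval t)) (fun t => p j (sval t)) (fun t => K / sval t) 0 t0).
  - by move=> x y; rewrite mulr_ge0 ?torus_cube_dist_ge0.
  - move=> x; rewrite /torus_cube_dist !big1 ?addr0 ?mulr0// => i _.
      by rewrite subrr normr0.
    by rewrite subrr cabs0.
  - move=> x y; rewrite /torus_cube_dist; congr (_ * (_ + _)); apply: eq_bigr => i _.
      exact: cabsB.
    exact: distrC.
  - move=> x y z; rewrite -mulrDr ler_wpM2l// /torus_cube_dist addrACA -!big_split /=.
    apply: lerD; apply: ler_sum => i _; last exact: ler_distD.
    have -> : circle_char (x.1 0 i) - circle_char (z.1 0 i) =
        (circle_char (x.1 0 i) - circle_char (y.1 0 i)) +
        (circle_char (y.1 0 i) - circle_char (z.1 0 i)) by rewrite addrA subrK.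
    exact: cabsD.
  - by move=> [E E1].
  - by move=> [E E1] /=; rewrite divr_ge0// ltW// (lt_trans ltr01).
  - by move=> [E E1] [E' E'1] /=; exact: pK.
pose q (x : X) j := sval (gP j) x.
have q_lip x y j : `|q x j - q y j| <= K * torus_cube_dist x y.
  by rewrite /q; case: (gP j) => g [gl _] /=; exact: gl.
have q_near E j : 1 < E -> `|p j E - q (log_orbit E) j| <= K / E.
  move=> E1; rewrite /q; case: (gP j) => g [_ gn] /=.
  by rewrite distrC; exact: (gn (exist _ E E1)).
pose L : R := 1 + J%:R *+ 2.
have L0 : 0 <= L by rewrite addr_ge0// mulrn_wge0.
exists (fun x => \row_j simplex_retract j0 (q x) j); split.
- move=> a b; split=> [|j]; last by rewrite mxE simplex_retract_ge0.
  by rewrite -(sum_simplex_retract j0 (q (a, b))); apply: eq_bigr => j _; rewrite mxE.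
- exists (L * (K * (n%:R * (4 * pi) + r%:R))) => a a' b b' _ _.
  apply: (@le_trans _ _ (L * (K * torus_cube_dist (a, b) (a', b')))); last first.
    by rewrite -!mulrA !ler_wpM2l// torus_cube_dist_le.
  apply: rV_norm_le => [|j]; first by rewrite !mulr_ge0 ?torus_cube_dist_ge0.
  by rewrite !mxE; apply: simplex_retract_lip => i; exact: q_lip.
- exists (L * K) => E E1 EE j; rewrite mxE -mulrA.
  rewrite -(@simplex_retract_id _ _ j0 (fun j => p j E) (p0^~ E) (p1 E EE) j).
  by apply: simplex_retract_lip => i; exact: q_near.
Qed.

End QuasiperiodicExtension.

Theorem theoremA (R : realType) (d : nat) (Phi : fieldExtType rat)
    (iota : {rmorphism Phi -> R}) (w : d.-tuple Phi) (omega : 'I_d -> R)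
    (hd : (1 <= d)%N)
    (hw : basis_of {:Phi}%VS (1 :: w))
    (homega : forall i, omega i = iota (tnth w i))
    (omega_gt0 : forall i, 0 < omega i) :
  exists (J : nat) (s : J.-tuple Phi) (u : R -> R),
    [/\ uniq s,
        forall E, 1 < E -> 1 < u E,
        forall E, 1 < E ->
          forall x, x \in rescaled_spacings omega u E ->
            exists j : 'I_J, x = iota (tnth s j)
      & exists (k r : nat)
          (g : 'rV[circle R]_k * 'rV[R]_r -> 'rV[R]_J)
          (theta : 'rV[R]_k) (beta : 'rV[R]_r) (alpha : R),
          [/\ (k <= d.+1)%N /\ (r <= d.+1)%N,
              forall a b, unit_cube b -> prob_simplex (g (a, b)),
              torus_cube_lipschitz g,
              0 < alpha < 1
            & exists C : R, \forall E \near +oo, forall j : 'I_J,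
                `|proportion (rescaled_spacings omega u E) (iota (tnth s j))
                  - g (to_torus (ln E *: theta),
                       map_mx (@frac_part R) (ln E *: beta)) 0 j|
                <= C * alpha `^ ln E]].
Proof.
pose bs : d.+1.-tuple Phi := [tuple of 1 :: w].
have bsP : basis_of {:Phi}%VS bs := hw.
have bs0 : bs`_0 = 1 by [].
have omegaE (i : 'I_d) : omega i = iota bs`_i.+1.
  by rewrite homega (tnth_nth 0).
have bs_gt0 (i : 'I_d.+1) : 0 < iota bs`_i.
  case: (unliftP ord0 i) => [j ->|->]; last by rewrite /= rmorph1 ltr01.
  by rewrite lift0 -omegaE.
have [sg [[A sg_coord] sg_norm emb]] := exists_embeddings bsP R[i].
have [k0 sg_k0] : exists k0, forall x, (iota x)%:C%C = sg k0 x.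
  exact: emb (real_complex R \o iota).
have [r [eta [b [rd etaU eta_gt0 etaE]]]] :=
  scaling_units bsP bs_gt0 sg_norm sg_k0.
pose su := scaling_unit sg eta b.
have suU E : lattice_unit bs (su E) := scaling_unit_unit bsP sg b etaU E.
have su_gt0 E : 0 < iota (su E).
  by rewrite rmorphM mulr_gt0//; exact: floor_unit_gt0.
have [S [S_uniq S0 S_lattice S_mem]] :=
  bounded_lattice_seq hd bsP (spacing_cst iota bs sg A eta).
have spacing_S E x y : 1 < E -> level bs x -> level bs y ->
    E <= iota x -> iota x < iota y -> iota y < E + 1 ->
    (forall z, level bs z -> iota x < iota z -> iota y <= iota z) ->
    su E * (y - x) \in S.
  move=> E1 xl yl Ex xy yE nxt.
  have [h1 h2] := spacing_bounded bsP bs_gt0 sg_coord sg_k0 etaU eta_gt0 etaE E1 xl yl Ex xy yE nxt.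
  exact: S_mem.
have /(_ _ _)/cid phiP l i := polar_exists (sg l (eta i)).
pose phi l i := sval (phiP l i).
have phiE l i : polar (sg l (eta i)) (phi l i) := svalP (phiP l i).
pose theta : 'rV[R]_d.+1 := \row_l angle b phi l.
pose beta : 'rV[R]_r := \row_i b i.
pose dist E E' := torus_cube_dist (log_orbit theta beta E) (log_orbit theta beta E').
have distE E E' : dist E E' = orbit_dist b phi E E'.
  rewrite /dist /torus_cube_dist /orbit_dist; congr (_ + _); apply: eq_bigr => i _.
    by rewrite /= !mxE !circle_charE.
  by rewrite /= !mxE /orbit_frac ![ln _ * _]mulrC.
have dist_ge0 E E' : 0 <= dist E E' by exact: torus_cube_dist_ge0.
have su_lip p j : approx_lip dist (fun E => ratr (coord bs j (p / su E)) / E).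
  have [C C0 hC] := co_scaling_unit_lip hd bsP sg_coord sg_k0 etaU eta_gt0 etaE phiE p j.
  by exists C => // E E'; rewrite distE; exact: hC.
pose J := size S; pose s : J.-tuple Phi := in_tuple S.
have sS j : tnth s j \in S by exact: mem_tnth.
pose u E := iota (su E).
have plip j := proportion_lip bsP bs_gt0 bs0 omegaE hd suU su_gt0 dist_ge0 su_lip S_lattice spacing_S (sS j).
have [E0 wE0] := window_size_gt1 bsP bs_gt0 bs0 omegaE hd.
exists J, s, u; split.
- exact: S_uniq.
- by move=> E; exact: scaling_unit_gt1.
- move=> E E1 x; rewrite /rescaled_spacings /spacings => /mapP[_ /mapP[i iw ->] ->].
  move: iw; rewrite mem_iota add0n /= ltn_predRL => iw.
  have [q [qS _ qE]] := spaced_S bsP bs_gt0 bs0 omegaE su_gt0 spacing_S E1 iw.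
  have jS : (index q S < J)%N by rewrite index_mem.
  by exists (Ordinal jS); rewrite (tnth_nth 0) /= nth_index.
have j0 : 'I_J by apply: (@Ordinal J 0%N); rewrite /J; case: (S) S0.
have [|||g [gP gL [C gC]]] := @quasiperiodic_extension R d.+1 r J j0 theta beta
  (fun j E => proportion (rescaled_spacings omega u E) (iota (tnth s j))) (Num.max 1 E0).
- by move=> j E; exact: proportion_ge0.
- move=> E; rewrite gt_max => /andP[E1 EE0].
  rewrite -(sum_proportion bsP bs_gt0 bs0 omegaE su_gt0 spacing_S E1 (wE0 E EE0) S_uniq (fun=> erefl)).
  by rewrite [RHS](big_nth 0) big_mkord; apply: eq_bigr => j _; rewrite (tnth_nth 0).
- exact: plip.
(* The exponential error term is 1/E. *)
exists d.+1, r, g, theta, beta, (expR (-1)); split=> //.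
  by rewrite expR_gt0 -[X in _ < X]expR0 ltr_expR oppr_lt0 ltr01.
exists C; near=> E => j.
have E1 : 1 < E by near: E; apply: nbhs_pinfty_gt; exact: num_real.
have EE0 : Num.max 1 E0 < E by near: E; apply: nbhs_pinfty_gt; exact: num_real.
have -> : expR (-1) `^ ln E = E^-1.
  rewrite -[RHS]lnK ?posrE ?invr_gt0 ?(lt_trans ltr01)// lnV ?posrE ?(lt_trans ltr01)//.
  by rewrite /powR gt_eqF ?expR_gt0// expRK mulrN1.
exact: gC.
Unshelve. all: by end_near.
Qed.
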